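(* Let $X$ and $Y$ be quasi-Banach spaces. Then $\operatorname{Ext}(X,Y)$ is Hausdorff if and only if $K_0(X,Y)$ is finite.
   Context: Scalars are real or complex. A quasi-norm on a linear space $X$ is a function $\|\cdot\|:X\to[0,\infty)$ vanishing only at $0$, with $\|\lambda x\|=|\lambda|\|x\|$ and $\|x+y\|\le\Delta(\|x\|+\|y\|)$ for some constant $\Delta$; a semi-quasi-norm is the same without the requirement that it vanish only at $0$; a semi-quasi-norm $\varrho$ induces the least linear topology for which $\{\varrho\le 1\}$ is a neighborhood of $0$. A quasi-Banach space is a complete quasi-normed space. Operators are continuous linear maps. A map $F:X\to Y$ between quasi-Banach spaces is homogeneous if $F(\lambda x)=\lambda F(x)$ for all scalars $\lambda$ and $x\in X$; a homogeneous map is bounded if $\|F\|:=\sup_{\|x\|\le1}\|F(x)\|<\infty$. $F$ is quasilinear if it is homogeneous and there is a constant $Q$ with $\|F(x+y)-F(x)-F(y)\|_Y\le Q(\|x\|_X+\|y\|_X)$ for all $x,y\in X$; the least such $Q$ is denoted $Q(F)$. $K_0(X,Y)$ is the infimum of those constants $C$ for which the following holds: if $F:X\to Y$ is a bounded quasilinear map, then there is a linear (not necessarily continuous) map $L:X\to Y$ such that $\|F-L\|\le C\,Q(F)$ (with $K_0(X,Y)=\infty$ if there is no such $C$). An extension of $X$ by $Y$ is a short exact sequence $0\to Y\xrightarrow{\imath}Z\xrightarrow{\pi}X\to0$ of quasi-Banach spaces and operators. Two extensions with middle spaces $Z,Z'$ are equivalent if there is an operator $t:Z\to Z'$ commuting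 with the identities of $Y$ and $X$. $\operatorname{Ext}(X,Y)$ is the linear space (Baer sum) of extensions modulo equivalence; its zero is the class of split extensions. It carries the linear topology induced by the semi-quasi-norm $\varrho([(\imath,\pi)])=\inf\varrho(\imath',\pi')$, the infimum over all extensions $0\to Y\xrightarrow{\imath'}Z'\xrightarrow{\pi'}X\to0$ equivalent to the given one, where $$\varrho(\imath,\pi)=\inf_B\ \sup_{x,y\in X}\frac{\|\imath^{-1}(B(x+y)-B(x)-B(y))\|_Y}{\|x\|_X+\|y\|_X},$$ and $B$ runs over all homogeneous bounded maps $B:X\to Z$ with $\pi\circ B=\mathrm{Id}_X$ (the supremum being over $(x,y)\neq(0,0)$). Equivalently, $\operatorname{Ext}(X,Y)$ is identified with the space $\mathcal Q(X,Y)$ of quasilinear maps $X\to Y$ modulo trivial ones (sums of a linear map and a bounded homogeneous map), with semi-quasi-norm $Q([F])=\inf\{Q(G):G-F\text{ trivial}\}$; the class of $F$ corresponds to the extension $0\to Y\to Y\oplus_FX\to X\to0$, where $Y\oplus_FX$ is $Y\times X$ with the quasi-norm $\|(y,x)\|_F=\|y-F(x)\|_Y+\|x\|_X$, and the maps are $y\mapsto(y,0)$ and $(y,x)\mapsto x$. *)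

(* Defs.v *)
From HB Require Import structures.
From mathcomp Require Import all_boot all_order all_algebra.
From mathcomp Require Import all_classical all_reals.
From mathcomp Require Import ereal topology normedtype.
From mathcomp Require Import complex.

Set Implicit Arguments.
Unset Strict Implicit.
Unset Printing Implicit Defensive.

Import Order.TTheory GRing.Theory Num.Theory.
Import numFieldNormedType.Exports.

Local Open Scope classical_set_scope.
Local Open Scope ring_scope.

Variant scalars := RealScalars | ComplexScalars.

Definition scalar (R : realType) (s : scalars) : numFieldType :=
  match s with RealScalars => R | ComplexScalars => R[i] end.

(* The library's norm on [R[i]] takes its values in [R[i]]; quasi-norms need an
   [R]-valued absolute value. *)
Definition modulus (R : realType) (s : scalars) : scalar R s -> R :=
  match s with
  | RealScalars => fun a : R => `|a|
  | ComplexScalars => fun a : R[i] => Normc.normc a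
  end.
Arguments modulus {R s}.

(* The uniform structure of a quasi-normed space is required to be the one of
   its quasi-norm, so that [continuous], [cauchy] and [-->] have their usual
   meaning. *)
HB.mixin Record isQuasiNormed (R : realType) (s : scalars) V
    & PreUniformLmodule (scalar R s) V := {
  qnorm : V -> R;
  qnorm_ge0 : forall x, 0 <= qnorm x;
  qnorm_eq0 : forall x, qnorm x = 0 -> x = 0;
  qnormZ : forall a x, qnorm (a *: x) = modulus a * qnorm x;
  qnormD_ex : exists D : R,
    forall x y, qnorm (x + y) <= D * (qnorm x + qnorm y);
  qnorm_entourageE : entourage =
    [set A : set (V * V) | exists2 e : R, 0 < e &
       [set xy : V * V | qnorm (xy.1 - xy.2) < e] `<=` A]
}.

#[short(type="quasiNormedType")]
HB.structure Definition QuasiNormed (R : realType) (s : scalars) :=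
  {V of isQuasiNormed R s V & PreUniformLmodule (scalar R s) V}.

(* The library's [Complete] is not reused: it carries a base point, for which
   it has no join with modules. *)
HB.mixin Record QuasiNormed_isComplete (R : realType) (s : scalars) V
    & QuasiNormed R s V := {
  qcomplete : forall F : set_system V,
    ProperFilter F -> cauchy F -> exists x : V, F --> x
}.

#[short(type="quasiBanachType")]
HB.structure Definition QuasiBanach (R : realType) (s : scalars) :=
  {V of QuasiNormed R s V & QuasiNormed_isComplete R s V}.

Section ProdQuasiBanach.
Context (R : realType) (s : scalars).

Section Normed.
Context (V W : quasiNormedType R s).

Definition prod_qnorm (p : V * W) : R := qnorm p.1 + qnorm p.2.

Let prod_qnorm_ge0 p : 0 <= prod_qnorm p.
Proof. by rewrite addr_ge0 // qnorm_ge0. Qed.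

Let prod_qnorm_eq0 p : prod_qnorm p = 0 -> p = 0.
Proof.
case: p => v w /eqP; rewrite paddr_eq0 ?qnorm_ge0 //= => /andP[/eqP v0 /eqP w0].
by rewrite (qnorm_eq0 v v0) (qnorm_eq0 w w0).
Qed.

Let prod_qnormZ a p : prod_qnorm (a *: p) = modulus a * prod_qnorm p.
Proof. by rewrite /prod_qnorm !qnormZ mulrDr. Qed.

Let prod_qnormD_ex : exists D : R,
  forall p q, prod_qnorm (p + q) <= D * (prod_qnorm p + prod_qnorm q).
Proof.
have [D1 h1] := @qnormD_ex _ _ V; have [D2 h2] := @qnormD_ex _ _ W.
exists (`|D1| + `|D2|) => -[v w] [v' w']; rewrite /prod_qnorm /= mulrDl.
apply: lerD; [apply: le_trans (h1 _ _) _|apply: le_trans (h2 _ _) _].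
- apply: le_trans (ler_wpM2r _ (ler_norm _)) _; rewrite ?addr_ge0 ?qnorm_ge0 //.
  by apply: ler_wpM2l => //; apply: lerD; rewrite lerDl qnorm_ge0.
- apply: le_trans (ler_wpM2r _ (ler_norm _)) _; rewrite ?addr_ge0 ?qnorm_ge0 //.
  by apply: ler_wpM2l => //; apply: lerD; rewrite lerDr qnorm_ge0.
Qed.

Let prod_entourageE : entourage =
  [set A : set ((V * W) * (V * W)) | exists2 e : R, 0 < e &
     [set xy | prod_qnorm (xy.1 - xy.2) < e] `<=` A].
Proof.
apply/seteqP; split=> A.
- case=> -[A1 A2] /= [].
  rewrite (@qnorm_entourageE _ _ V) (@qnorm_entourageE _ _ W).
  move=> [e1 e1_gt0 s1] [e2 e2_gt0 s2] sA.
  exists (Num.min e1 e2); first by rewrite lt_min e1_gt0.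
  case=> -[v w] [v' w'] /=; rewrite lt_min /prod_qnorm /= => /andP[l1 l2].
  have : (A1 `*` A2) ((v, v'), (w, w')).
    split; [apply: s1|apply: s2] => /=.
      by apply: le_lt_trans l1; rewrite lerDl qnorm_ge0.
    by apply: le_lt_trans l2; rewrite lerDr qnorm_ge0.
  by move=> /sA[[[a b] [c d]] Aabcd [<- <- <- <-]].
- move=> [e e_gt0 sA].
  have e2_gt0 : 0 < e / 2 by rewrite divr_gt0.
  exists ([set xy | qnorm (xy.1 - xy.2) < e / 2],
          [set xy | qnorm (xy.1 - xy.2) < e / 2]); first split => /=.
  + by rewrite (@qnorm_entourageE _ _ V); exists (e / 2).
  + by rewrite (@qnorm_entourageE _ _ W); exists (e / 2).
  + case=> -[v v'] [w w'] /= [l1 l2].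
    exists ((v, w), (v', w')) => //; apply: sA => /=.
    by rewrite /prod_qnorm (splitr e) ltrD.
Qed.

HB.instance Definition _ := isQuasiNormed.Build R s (V * W)%type
  prod_qnorm_ge0 prod_qnorm_eq0 prod_qnormZ prod_qnormD_ex prod_entourageE.

End Normed.

Section Complete.
Context (V W : quasiBanachType R s).

Let prod_complete (F : set_system (V * W)) :
  ProperFilter F -> cauchy F -> exists x : V * W, F --> x.
Proof.
move=> FF cF.
have cauchy1 : cauchy (fst @ F).
  move=> A; rewrite (@qnorm_entourageE _ _ V) => -[e e_gt0 sA].
  have := cF [set xy | prod_qnorm (xy.1 - xy.2) < e].
  rewrite (@qnorm_entourageE _ _ (V * W)%type) => /(_ (ex_intro2 _ _ e e_gt0 _)).
  move=> /(_ (fun _ h => h)) [[P Q] /= [FP FQ] sPQ].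
  exists (fst @` P, fst @` Q); first by split;
    [apply: filterS FP|apply: filterS FQ] => p ?; exists p.
  case=> _ _ /= [[p Pp <-] [q Qq <-]]; apply: sA => /=.
  have /= := sPQ (p, q) (conj Pp Qq); apply: le_lt_trans.
  by rewrite lerDl qnorm_ge0.
have cauchy2 : cauchy (snd @ F).
  move=> A; rewrite (@qnorm_entourageE _ _ W) => -[e e_gt0 sA].
  have := cF [set xy | prod_qnorm (xy.1 - xy.2) < e].
  rewrite (@qnorm_entourageE _ _ (V * W)%type) => /(_ (ex_intro2 _ _ e e_gt0 _)).
  move=> /(_ (fun _ h => h)) [[P Q] /= [FP FQ] sPQ].
  exists (snd @` P, snd @` Q); first by split;
    [apply: filterS FP|apply: filterS FQ] => p ?; exists p.
  case=> _ _ /= [[p Pp <-] [q Qq <-]]; apply: sA => /=.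
  have /= := sPQ (p, q) (conj Pp Qq); apply: le_lt_trans.
  by rewrite lerDr qnorm_ge0.
have [v Fv] := qcomplete _ _ cauchy1; have [w Fw] := qcomplete _ _ cauchy2.
exists (v, w) => A [[A1 A2] [/= A1v A2w]] sA.
have F1 : F (fst @^-1` A1) := Fv _ A1v; have F2 : F (snd @^-1` A2) := Fw _ A2w.
by apply: filterS (filterI F1 F2) => -[a b] /= ?; exact: sA.
Qed.

HB.instance Definition _ :=
  QuasiNormed_isComplete.Build R s (V * W)%type prod_complete.

End Complete.
End ProdQuasiBanach.

Section QuasilinearMaps.
Context (R : realType) (s : scalars).
Local Notation K := (scalar R s).

Definition homogeneous (V W : quasiNormedType R s) (F : V -> W) : Prop :=
  forall (a : K) x, F (a *: x) = a *: F x.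

Definition hnorm (V W : quasiNormedType R s) (F : V -> W) : \bar R :=
  ereal_sup [set (qnorm (F x))%:E | x in [set x | qnorm x <= 1]].

Definition homogeneous_bounded (V W : quasiNormedType R s) (F : V -> W) : Prop :=
  homogeneous F /\ (hnorm F < +oo)%E.

Definition quasilinear_constants (V W : quasiNormedType R s) (F : V -> W) :
    set R :=
  [set Q | 0 <= Q /\ forall x y,
     qnorm (F (x + y) - F x - F y) <= Q * (qnorm x + qnorm y)].

Definition quasilinear (V W : quasiNormedType R s) (F : V -> W) : Prop :=
  homogeneous F /\ quasilinear_constants F !=set0.

Definition quasilinearity (V W : quasiNormedType R s) (F : V -> W) : R :=
  inf (quasilinear_constants F).

Definition K0 (X Y : quasiBanachType R s) : \bar R :=
  ereal_inf [set C%:E | C in [set C : R | 0 <= C /\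
    forall F : X -> Y, quasilinear F -> homogeneous_bounded F ->
      exists L : {linear X -> Y},
        (hnorm (F \- L)%R <= (C * quasilinearity F)%R%:E)%E]].

End QuasilinearMaps.

(* The carrier [E] is only a [Type]: the type of all extensions lies in too high
   a universe for the library's algebraic and topological structures.  Hence a
   topology is given by its open sets, and the operations of the linear space
   [E] are parameters. *)
Section LinearTopologies.
Context (R : realType) (s : scalars).
Local Notation K := (scalar R s).
Context (E : Type) (zero : E) (add : E -> E -> E) (scale : K -> E -> E).
Implicit Types O : (E -> Prop) -> Prop.

Definition is_topology O : Prop :=
  [/\ O (fun=> True),
      forall U V, O U -> O V -> O (fun x => U x /\ V x)
    & forall D : (E -> Prop) -> Prop, (forall U, D U -> O U) ->
        O (fun x => exists2 U, D U & U x)].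

Definition linear_topology O : Prop :=
  [/\ is_topology O,
      forall x y U, O U -> U (add x y) ->
        exists V W, [/\ O V, V x, O W, W y
          & forall x' y', V x' -> W y' -> U (add x' y')]
    & forall a x U, O U -> U (scale a x) ->
        exists (A : set K) (V : E -> Prop), [/\ nbhs a A, O V, V x
          & forall a' x', A a' -> V x' -> U (scale a' x')]].

Definition is_neighborhood O (x : E) (N : E -> Prop) : Prop :=
  exists U, [/\ O U, U x & forall y, U y -> N y].

(* The least linear topology for which [r <= 1] is a neighborhood of [zero]: its
   open sets are those common to all such topologies. *)
Definition induced_topology (r : E -> \bar R) : (E -> Prop) -> Prop :=
  fun U => forall O, linear_topology O ->
    is_neighborhood O zero (fun x => (r x <= 1)%E) -> O U.

Definition hausdorff O : Prop :=
  forall x y, x <> y -> exists U V,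
    [/\ O U, U x, O V, V y & forall z, ~ (U z /\ V z)].

End LinearTopologies.

Section Extensions.
Context (R : realType) (s : scalars).
Local Notation K := (scalar R s).

Record extension (X Y : quasiBanachType R s) := Extension {
  ext_mid : quasiBanachType R s;
  ext_inj : {linear Y -> ext_mid};
  ext_proj : {linear ext_mid -> X};
  ext_inj_continuous : continuous ext_inj;
  ext_proj_continuous : continuous ext_proj;
  ext_inj_injective : injective ext_inj;
  ext_proj_surjective : range ext_proj = setT;
  ext_exact : range ext_inj = ext_proj @^-1` [set 0]
}.

Section Fixed.
Context (X Y : quasiBanachType R s).
Implicit Types e : extension X Y.

Definition ext_equiv e e' : Prop :=
  exists t : {linear ext_mid e -> ext_mid e'},
    [/\ continuous t, t \o ext_inj e =1 ext_inj e'
      & ext_proj e' \o t =1 ext_proj e].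

Definition equiv_class e : extension X Y -> Prop := fun e' => ext_equiv e e'.

Record Ext := MkExt {
  ext_members : extension X Y -> Prop;
  ext_membersP : exists e, ext_members = equiv_class e
}.

Definition ext_class e : Ext := MkExt (ex_intro _ e (erefl (equiv_class e))).

Definition split_inj (y : Y) : Y * X := (y, 0).

Let split_inj_linear : linear split_inj.
Proof. by move=> a y y'; rewrite /split_inj; congr pair; rewrite /= scaler0 addr0. Qed.
HB.instance Definition _ := GRing.isLinear.Build K Y (Y * X)%type _ split_inj
  split_inj_linear.

Definition split_proj (p : Y * X) : X := p.2.

Let split_proj_linear : linear split_proj.
Proof. by []. Qed.
HB.instance Definition _ := GRing.isLinear.Build K (Y * X)%type X _ split_proj
  split_proj_linear.

Let split_inj_continuous : continuous split_inj.
Proof. by move=> y; apply: cvg_pair; [exact: cvg_id|exact: cvg_cst]. Qed.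

Let split_proj_continuous : continuous split_proj.
Proof. by move=> p; exact: cvg_snd. Qed.

Let split_inj_injective : injective split_inj.
Proof. by move=> y y' []. Qed.

Let split_proj_surjective : range split_proj = setT.
Proof. by apply/seteqP; split=> // x _; exists (0, x). Qed.

Let split_exact : range split_inj = split_proj @^-1` [set 0].
Proof.
apply/seteqP; split=> [_ [y _ <-] //|[y x] /= ->]; by exists y.
Qed.

Definition split_extension : extension X Y :=
  @Extension X Y (Y * X)%type split_inj split_proj split_inj_continuous
    split_proj_continuous split_inj_injective split_proj_surjective split_exact.

Definition ext0 : Ext := ext_class split_extension.

(* The Baer sum is the pushout along [+ : Y * Y -> Y] of the pullback along the
   diagonal of [X] of the direct sum of [e1] and [e2].  Up to equivalence a
   pushout is the only extension receiving a morphism of extensions that is the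
   given map on the left and the identity on the right; [T] is that morphism,
   defined on the pullback
   [0 -> Y * Y -> {(z1, z2) | ext_proj e1 z1 = ext_proj e2 z2} -> X -> 0]
   (its values elsewhere are irrelevant). *)
Definition is_baer_sum e1 e2 e3 : Prop :=
  let P := [set p : ext_mid e1 * ext_mid e2 |
              ext_proj e1 p.1 = ext_proj e2 p.2] in
  exists T : ext_mid e1 * ext_mid e2 -> ext_mid e3,
    [/\ forall (a : K) p q, P p -> P q -> T (a *: p + q) = a *: T p + T q,
        {within P, continuous T},
        forall y1 y2, T (ext_inj e1 y1, ext_inj e2 y2) = ext_inj e3 (y1 + y2)
      & forall p, P p -> ext_proj e3 (T p) = ext_proj e1 p.1].

(* Likewise, the multiple by [a] is the pushout along [a *: _ : Y -> Y]. *)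
Definition is_multiple (a : K) e e' : Prop :=
  exists T : {linear ext_mid e -> ext_mid e'},
    [/\ continuous T, forall y, T (ext_inj e y) = ext_inj e' (a *: y)
      & ext_proj e' \o T =1 ext_proj e].

(* The class satisfying [P]; in both uses below there is exactly one. *)
Definition ext_the (P : Ext -> Prop) : Ext :=
  if pselect (exists c, P c) is left ex_c then sval (cid ex_c) else ext0.

Definition ext_add (c1 c2 : Ext) : Ext :=
  ext_the (fun c => exists e1 e2 e3,
    [/\ c1 = ext_class e1, c2 = ext_class e2, c = ext_class e3
      & is_baer_sum e1 e2 e3]).

Definition ext_scale (a : K) (c : Ext) : Ext :=
  ext_the (fun c' => exists e e',
    [/\ c = ext_class e, c' = ext_class e' & is_multiple a e e']).

Definition bounded_section e (B : X -> ext_mid e) : Prop :=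
  homogeneous_bounded B /\ forall x, ext_proj e (B x) = x.

(* [w] is [ext_inj e]^-1 (B (x + y) - B x - B y).  The pair [x = y = 0]
   contributes [0 / 0 = 0], which makes the supremum [0] when [X] is zero. *)
Definition rho_section e (B : X -> ext_mid e) : \bar R :=
  ereal_sup [set r : \bar R | exists x y w,
    ext_inj e w = B (x + y) - B x - B y /\
    r = (qnorm w / (qnorm x + qnorm y))%:E].

Definition rho_extension e : \bar R :=
  ereal_inf [set rho_section B | B in @bounded_section e].

Definition rho (c : Ext) : \bar R :=
  ereal_inf [set r : \bar R | exists2 e, ext_members c e & r = rho_extension e].

Definition ext_topology : (Ext -> Prop) -> Prop :=
  induced_topology ext0 ext_add ext_scale rho.

End Fixed.
End Extensions.

Arguments ext_topology {R s} X Y.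

(* Main.v *)
Require Import Defs.
From HB Require Import structures.
From mathcomp Require Import all_boot all_order all_algebra.
From mathcomp Require Import all_classical all_reals.
From mathcomp Require Import ereal topology normedtype.
From mathcomp Require Import complex ring lra.
From mathcomp.multinomials Require Import freeg.

(** Call a quasilinear map trivial if it is the sum of a linear and of a bounded
    homogeneous map. Consider the inclusion of the bounded homogeneous maps, with
    the supremum norm, into the quasilinear maps, with the semi-quasi-norm given
    by the defect constant. The kernel of that semi-quasi-norm is the set of
    linear maps, so modulo the kernel the range of the inclusion is the set of
    trivial maps. Both sides of the theorem are properties of this inclusion.

    - The finiteness of [K0 X Y] says that the inclusion is open onto its range
      ([K0_fin_numP]): a bounded map of small defect differs by a linear map from
      a bounded map of small norm.
    - That [Ext X Y] is Hausdorff says that the range is closed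
      ([hausdorff_extP]): [Ext X Y] is the quotient of the quasilinear maps by the
      trivial ones, and [rho] induces the quotient semi-quasi-norm.

    Since both spaces are complete, a closed range is equivalent to openness onto
    the range, by the open mapping theorem in one direction and by a convergent
    sum in the other ([closed_range_open], [open_closed_range]). The completeness
    of the space of quasilinear maps ([dgauge_complete]) is the point that needs
    an idea. A sequence which is Cauchy for the defect need not converge
    pointwise; but every quasilinear map can be corrected by a linear map so that
    its values are bounded pointwise by its defect constant
    ([dgauge_linear_part]), and the corrected sequence does converge.

    The identification of [Ext X Y] with that quotient uses the open mapping
    theorem again: it gives each extension a bounded homogeneous section. The
    difference of a bounded and of a linear section takes its values in [Y] and
    is a quasilinear map [F] ([section_represents]); the extension is equivalent
    to the twisted sum of [F] ([represents_equiv]). Baer sums and multiples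
    correspond to sums and multiples of maps ([ext_ofD], [ext_ofZ]). Finally, the
    topology induced by [rho], defined as an intersection of linear topologies, is
    the one whose neighbourhoods are the balls ([gauge_open_linear],
    [gauge_open_least]). *)

Set Implicit Arguments.
Unset Strict Implicit.
Unset Printing Implicit Defensive.

Import Order.TTheory GRing.Theory Num.Theory.
Import numFieldNormedType.Exports.

Local Open Scope classical_set_scope.
Local Open Scope ring_scope.

(** * Linear sections and free modules *)

Section LinearAlgebra.
Context (K : fieldType).

Lemma linear_map_of (A B : lmodType K) (f : A -> B) :
  linear f -> exists g : {linear A -> B}, g =1 f.
Proof.
move=> flin; pose m := GRing.isLinear.Build K A B _ f flin.
by pose g : {linear A -> B} := HB.pack f m; exists g.
Qed.

(** A submodule maximal among those meeting the kernel trivially is a complement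
    of the kernel, and the map is bijective on it. *)
Lemma linear_section (A B : lmodType K) (T : {linear A -> B}) :
  (forall b, exists a, T a = b) -> exists S : {linear B -> A}, cancel S T.
Proof.
move=> Tsurj.
pose indep (N : set A) := [/\ forall k x y, N x -> N y -> N (k *: x + y)
  & forall x, N x -> T x = 0 -> x = 0].
have [|N [[NL N0] Nmax]] := @Zorn_bigcup A indep.
  move=> F Findep Ftot; split.
    move=> k x y [P FP Px] [Q FQ Qy].
    case: (Ftot P Q FP FQ) => [PQ|QP].
      by exists Q => //; apply: (Findep Q FQ).1 => //; exact: PQ.
    by exists P => //; apply: (Findep P FP).1 => //; exact: QP.
  by move=> x [P FP Px]; apply: (Findep P FP).2.
have Nzero : N 0.
  apply: contrapT => Nn0.
  pose N' := [set x : A | x = 0].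
  have : N `<` N' -> False.
    move=> /Nmax; apply; split => [k x y -> ->|x -> //].
    by rewrite /N' /= scaler0 addr0.
  apply; split; last by move=> N0N; apply: Nn0; exact: N0N.
  move=> x Nx; exfalso; apply: Nn0.
  have := NL (-1) x x Nx Nx; by rewrite scaleN1r addNr.
have NZ k x : N x -> N (k *: x) by move=> Nx; rewrite -[_ *: _]addr0; exact: NL.
have NB x y : N x -> N y -> N (x - y).
  by move=> Nx Ny; rewrite addrC -scaleN1r; exact: NL.
have Nonto b : exists2 a, N a & T a = b.
  apply: contrapT => nb; have [a Ta] := Tsurj b.
  pose N' := [set z : A | exists n k, N n /\ z = n + k *: a].
  have : N `<` N' -> False.
    move=> /Nmax; apply; split.
      move=> k _ _ [n [l [Nn ->]]] [n' [l' [Nn' ->]]].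
      exists (k *: n + n'), (k * l + l'); split; first exact: NL.
      by rewrite scalerDr scalerDl scalerA addrACA.
    move=> _ [n [l [Nn ->]]]; rewrite linearD linearZ /= Ta => Tn.
    have [l0|l0] := eqVneq l 0.
      by move: Tn; rewrite l0 !scale0r !addr0; exact: N0.
    exfalso; apply: nb; exists (- l^-1 *: n); first exact: NZ.
    rewrite linearZ /= (_ : T n = - (l *: b)); last by apply/eqP; rewrite -addr_eq0 Tn.
    by rewrite scaleNr scalerN opprK scalerA mulVf // scale1r.
  apply; split=> [n Nn|N'N]; first by exists n, 0; rewrite scale0r addr0.
  apply: nb; exists a => //; apply: N'N; exists 0, 1; by rewrite add0r scale1r.
have /choice[S SP] : forall b, exists a, N a /\ T a = b.
  by move=> b; have [a Na Ta] := Nonto b; exists a.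
have [|g gS] := @linear_map_of B A S; last first.
  by exists g => b; rewrite gS; exact: (SP b).2.
move=> k x y; apply/eqP; rewrite -subr_eq0; apply/eqP; apply: N0.
  by apply: NB; [exact: (SP _).1|apply: NL; exact: (SP _).1].
by rewrite linearB linearD linearZ /= !(SP _).2 subrr.
Qed.

Lemma fglift_linear (X : choiceType) (V : lmodType K) (f : X -> V) :
  linear (@fglift K V X f).
Proof.
have fD : additive (@fglift K V X f) by exact: lift_is_additive.
pose m := GRing.isAdditive.Build _ _ _ fD.
pose g : {additive {freeg X / K} -> V} := HB.pack (@fglift K V X f) m.
have gE (D : {freeg X / K}) : fglift f D = g D by [].
move=> k D E; rewrite !gE raddfD; congr (_ + _).
rewrite [k *: D]/(fgscale k D) /fgscale raddf_sum -[in RHS](freeg_sumE D) raddf_sum.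
rewrite scaler_sumr; apply: eq_bigr => x _.
by rewrite -!gE !liftU scalerA.
Qed.

End LinearAlgebra.

(** * Scalars and gauges *)

Section Scalars.
Context (R : realType) (s : scalars).
Local Notation K := (Defs.scalar R s).

Definition of_real : R -> K :=
  match s return R -> Defs.scalar R s with
  | RealScalars => id | ComplexScalars => real_complex R end.

Lemma normr_modulus (a : K) : `|a| = of_real (modulus a).
Proof.
rewrite /of_real /modulus; case: s a => [a|a]; first by [].
by rewrite [LHS]normc_def; case: a.
Qed.

Lemma le_of_real x y : (of_real x <= of_real y) = (x <= y).
Proof. by rewrite /of_real; case: s => //=; exact: lecR. Qed.

Lemma lt_of_real x y : (of_real x < of_real y) = (x < y).
Proof. by rewrite /of_real; case: s => //=; exact: ltcR. Qed.

Lemma of_real_inj : injective of_real.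
Proof. by move=> x y xy; apply/eqP; rewrite eq_le -!le_of_real xy lexx. Qed.

Lemma of_real0 : of_real 0 = 0.
Proof. by rewrite /of_real; case: s. Qed.

Lemma of_real1 : of_real 1 = 1.
Proof. by rewrite /of_real; case: s. Qed.

Lemma of_realM x y : of_real (x * y) = of_real x * of_real y.
Proof. by rewrite /of_real; case: s => //; exact: (rmorphM (real_complex R)). Qed.

Lemma of_realD x y : of_real (x + y) = of_real x + of_real y.
Proof. by rewrite /of_real; case: s => //; exact: (rmorphD (real_complex R)). Qed.

Lemma modulus_ge0 (a : K) : 0 <= modulus a.
Proof. by rewrite -le_of_real -normr_modulus of_real0. Qed.

Lemma modulus0 : modulus (0 : K) = 0.
Proof. by apply: of_real_inj; rewrite -normr_modulus normr0 of_real0. Qed.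

Lemma modulus1 : modulus (1 : K) = 1.
Proof. by apply: of_real_inj; rewrite -normr_modulus normr1 of_real1. Qed.

Lemma modulusN (a : K) : modulus (- a) = modulus a.
Proof. by apply: of_real_inj; rewrite -!normr_modulus normrN. Qed.

Lemma modulusD (a b : K) : modulus (a + b) <= modulus a + modulus b.
Proof. by rewrite -le_of_real of_realD -!normr_modulus ler_normD. Qed.

Lemma modulus_of_real x : 0 <= x -> modulus (of_real x) = x.
Proof.
move=> x0; apply: of_real_inj; rewrite -normr_modulus ger0_norm //.
by rewrite -of_real0 le_of_real.
Qed.

Lemma nbhs_scalar (a : K) e : 0 < e -> nbhs a [set b : K | modulus (b - a) < e].
Proof.
move=> e0; apply/nbhs_ballP; exists (of_real e); first by rewrite /= -of_real0 lt_of_real.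
by move=> b; rewrite -ball_normE /= distrC normr_modulus lt_of_real.
Qed.

End Scalars.
Arguments of_real {R s}.

(** The relation [the size of v is at most r] of a semi-quasi-norm which may be
    infinite. With it the bounded homogeneous maps and the quasilinear maps need
    not be made into types of their own: they are the vectors of finite size for
    two gauges on the space of all maps. *)
Section Gauges.
Context (R : realType) (s : scalars).
Local Notation K := (Defs.scalar R s).

Record gauge (V : lmodType K) (D : R) (N : V -> R -> Prop) : Prop := Gauge {
  gauge_ge0 : forall v r, N v r -> 0 <= r;
  gauge_le : forall v r t, N v r -> r <= t -> N v t;
  gauge0 : N 0 0;
  gaugeD : forall u v r t, N u r -> N v t -> N (u + v) (D * (r + t));
  gaugeZ : forall a v r, N v r -> N (a *: v) (modulus a * r)
}.

(** Only sequences with geometrically decreasing steps have to converge: for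
    these the triangle inequality, with constant [D], bounds all differences. *)
Definition geometric (D : R) (r : nat -> R) : Prop :=
  (forall k, 0 <= r k) /\ forall k, r k.+1 <= r k / (2 * D).

Definition gauge_complete (V : lmodType K) (D : R) (N : V -> R -> Prop) : Prop :=
  exists2 c, 0 <= c & forall (v : nat -> V) (r : nat -> R), geometric D r ->
    (forall k, N (v k.+1 - v k) (r k)) ->
    exists l, forall k, N (l - v k) (c * r k).

Definition gauge_dom (V : lmodType K) (N : V -> R -> Prop) (v : V) : Prop :=
  exists r, N v r.

Lemma geometric_small D r : 1 <= D -> geometric D r ->
  forall e, 0 < e -> forall n, exists2 k, (n <= k)%N & r k <= e.
Proof.
move=> D1 [r0 rS] e e0 n.
have rk k : r k <= r 0%N * (2^-1) ^+ k.
  elim: k => [|k IH]; first by rewrite expr0 mulr1.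
  apply: le_trans (rS k) _; rewrite exprSr mulrA; apply: ler_pM => //.
    by rewrite invr_ge0; lra.
  by rewrite lef_pV2 ?posrE; lra.
have rn : exists2 k, (n <= k)%N & r 0%N * (2^-1) ^+ k <= e.
  set m := Num.bound (r 0%N / e).
  exists (maxn n m); first exact: leq_maxl.
  have : r 0%N / e < 2 ^+ maxn n m.
    apply: lt_le_trans (upper_nthrootP (leqnn m)) _.
    by apply: ler_weXn2l; [lra|exact: leq_maxr].
  rewrite ltr_pdivrMr // => /ltW; rewrite exprVn ler_pdivrMr ?exprn_gt0 //.
  by rewrite mulrC.
by have [k nk kP] := rn; exists k => //; exact: le_trans (rk k) kP.
Qed.

Lemma geometric_powers D c : 1 <= D -> 0 <= c ->
  geometric D (fun k => c / (2 * D) ^+ k).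
Proof.
move=> D1 c0; split=> k; first by apply: divr_ge0 => //; apply: exprn_ge0; lra.
by rewrite exprSr invfM mulrA.
Qed.

Lemma geometricZ D c r : 0 <= c -> geometric D r -> geometric D (fun k => c * r k).
Proof.
move=> c0 [r0 rS]; split=> k; first exact: mulr_ge0.
by rewrite -mulrA; exact: ler_wpM2l.
Qed.

Section GaugeTheory.
Context (V : lmodType K) (D : R) (N : V -> R -> Prop).
Hypothesis (gN : gauge D N) (D1 : 1 <= D).

Lemma gaugeN v r : N v r -> N (- v) r.
Proof. by move=> /(gaugeZ gN (-1)); rewrite modulusN modulus1 mul1r scaleN1r. Qed.

Lemma gaugeB u v r t : N u r -> N v t -> N (u - v) (D * (r + t)).
Proof. by move=> ur /gaugeN; exact: gaugeD. Qed.

Lemma gauge_distC u v r : N (u - v) r -> N (v - u) r.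
Proof. by move=> /gaugeN; rewrite opprB. Qed.

Lemma gauge_tri u v w r t : N (u - v) r -> N (v - w) t -> N (u - w) (D * (r + t)).
Proof. by move=> uv /(gaugeD gN uv); rewrite addrA subrK. Qed.

Lemma gauge_domD u v : gauge_dom N u -> gauge_dom N v -> gauge_dom N (u + v).
Proof. by move=> [r ur] [t vt]; exists (D * (r + t)); exact: gaugeD. Qed.

Lemma gauge_domZ a v : gauge_dom N v -> gauge_dom N (a *: v).
Proof. by move=> [r vr]; exists (modulus a * r); exact: (gaugeZ gN). Qed.

Lemma gauge_domB u v : gauge_dom N u -> gauge_dom N v -> gauge_dom N (u - v).
Proof. by move=> [r ur] [t vt]; exists (D * (r + t)); exact: gaugeB. Qed.

Lemma gauge_geometric (v : nat -> V) r : geometric D r ->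
  (forall k, N (v k.+1 - v k) (r k)) ->
  forall n k, N (v (n + k)%N - v k) (2 * D * r k).
Proof.
have D1' := D1; move=> [r0 rS] vr; elim=> [|n IH] k.
  rewrite subrr; apply: (gauge_le gN (gauge0 gN)).
  by apply: mulr_ge0 (r0 k); lra.
rewrite addSnnS; apply: (gauge_le gN (gauge_tri (IH k.+1) (vr k))).
have D20 : 0 < 2 * D by lra.
have : r k.+1 * (2 * D) <= r k by rewrite -ler_pdivlMr.
move=> /(ler_wpM2l (_ : 0 <= D)) => /(_ ltac:(lra)); lra.
Qed.

End GaugeTheory.
End Gauges.

(** * The open mapping theorem for gauges *)

Section OpenMapping.
Context (R : realType) (s : scalars).
Local Notation K := (Defs.scalar R s).

Definition gauge_null (V : lmodType K) (N : V -> R -> Prop) (v : V) : Prop :=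
  forall e : R, 0 < e -> N v e.

Lemma gauge_nullD (V : lmodType K) D (N : V -> R -> Prop) : gauge D N -> 1 <= D ->
  forall u v, gauge_null N u -> gauge_null N v -> gauge_null N (u + v).
Proof.
move=> gN D1 u v u0 v0 e e0; have de : 0 < e / (2 * D) by apply: divr_gt0; lra.
have := gaugeD gN (u0 _ de) (v0 _ de); congr (N _ _).
by field; lra.
Qed.

Lemma gauge_null_limit (V : lmodType K) D (N : V -> R -> Prop) : gauge D N -> 1 <= D ->
  forall v c r, geometric D r -> 0 <= c -> (forall k, N v (c * r k)) ->
  gauge_null N v.
Proof.
move=> gN D1 v c r rg c0 vr e e0.
have [k _ rk] := geometric_small D1 (geometricZ c0 rg) e0 0.
exact: (gauge_le gN (vr k)).
Qed.

Context (V W : lmodType K) (D : R).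
Context (N : V -> R -> Prop) (M : W -> R -> Prop) (f : {linear V -> W}).

(** Points of [W] are compared modulo null vectors, since the semi-quasi-norm may
    vanish at nonzero vectors. *)
Definition closed_range : Prop :=
  forall w, (forall e : R, 0 < e -> exists2 v, gauge_dom N v & M (w - f v) e) ->
    exists2 v, gauge_dom N v & gauge_null M (w - f v).

Definition open_onto_range : Prop :=
  exists2 C, 0 <= C & forall v r, gauge_dom N v -> M (f v) r ->
    exists2 v', N v' (C * r) & gauge_null M (f v - f v').

Hypotheses (D1 : 1 <= D) (gN : gauge D N) (gM : gauge D M).
Hypotheses (cN : gauge_complete D N).
Hypothesis (f_bounded : exists2 c, 0 <= c & forall v r, N v r -> M (f v) (c * r)).

(** Baire's theorem for the closed range of [f], covered by the closures of the
    images of the balls of radius [n]: were none of them to have an interior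
    point, nested balls avoiding one closure after the other would shrink to a
    point of the range outside all the images. *)
Lemma range_ball_approximated : gauge_complete D M -> closed_range ->
  exists n v0 (r0 : R), [/\ 0 < r0, gauge_dom N v0 & forall v, gauge_dom N v ->
    M (f v - f v0) r0 -> forall e : R, 0 < e ->
      exists2 v', N v' n%:R & M (f v - f v') e].
Proof.
move=> [c c0 cP] f_closed; have D1' := D1; apply: contrapT => noball.
have step (n : nat) (p : V * R) : exists q : V * R,
    gauge_dom N p.1 -> 0 < p.2 ->
    [/\ gauge_dom N q.1, 0 < q.2, M (f q.1 - f p.1) p.2, q.2 <= p.2 / (2 * D)
      & forall v, N v n%:R -> ~ M (f q.1 - f v) (D * (c * q.2 + q.2))].
  have [[p1 p2]|np] := pselect (gauge_dom N p.1 /\ 0 < p.2); last first.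
    by exists p => p1 p2; case: np.
  apply: contrapT => nq; apply: noball; exists n, p.1, p.2; split=> // v dv vp e e0.
  apply: contrapT => nv'; apply: nq.
  pose t := Num.min (p.2 / (2 * D)) (e / (D * (c + 1))).
  have Dc0 : 0 < D * (c + 1) by apply: mulr_gt0; lra.
  have t0 : 0 < t by rewrite lt_min; apply/andP; split; apply: divr_gt0 => //; lra.
  (* The limit of the images will lie within [c * t] of [f v]; together with
     a later error [t] this must stay below [e]. *)
  exists (v, t) => _ _; split=> //=; first by rewrite ge_min lexx.
  move=> v' Nv' Mv'; apply: nv'; exists v' => //.
  have te : t * (D * (c + 1)) <= e by rewrite -ler_pdivlMr // ge_min lexx orbT.
  by apply: (gauge_le gM Mv'); rewrite /=; lra.
have [next nextP] := choice (fun np => step np.1 np.2).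
pose x := fix x n := if n is m.+1 then next (m, x m) else (0 : V, 1 : R).
have xP n : gauge_dom N (x n).1 /\ 0 < (x n).2.
  elim: n => [|n [IH1 IH2]] /=; first by split=> //; exists 0; exact: (gauge0 gN).
  by have [] := nextP (n, x n) IH1 IH2.
have xS n := nextP (n, x n) (xP n).1 (xP n).2.
have xg : geometric D (fun n => (x n).2).
  by split=> n; [exact: ltW (xP n).2|have [] := xS n].
have [|w wP] := cP (fun n => f (x n).1) _ xg; first by move=> n; have [] := xS n.
have [|v [r vr] vw] := f_closed w.
  move=> e e0; have [k _ rk] := geometric_small D1 (geometricZ c0 xg) e0 0.
  by exists (x k).1; [exact: (xP k).1|exact: (gauge_le gM (wP k))].
pose n := Num.bound r.
have nr : r <= n%:R by apply: ltW; exact: archi_boundP (gauge_ge0 gN vr).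
have [_ _ _ _ /(_ v (gauge_le gN vr nr))] := xS n; apply.
have xn : 0 < (x n.+1).2 := (xP n.+1).2.
exact: (gauge_tri gM (gauge_distC gM (wP n.+1)) (vw _ xn)).
Qed.

(** A small vector [f v] of the range is the difference of two points close to
    the interior point [f v0], and both are approximated; homogeneity turns this
    into a bound at every scale. *)
Lemma range_approximated : gauge_complete D M -> closed_range ->
  exists2 C, 0 <= C & forall v r, gauge_dom N v -> M (f v) r ->
    forall e : R, 0 < e -> exists2 v', N v' (C * r) & M (f v - f v') e.
Proof.
move=> cM f_closed; have D1' := D1.
have [n [v0 [r0 [r00 dv0 ballP]]]] := range_ball_approximated cM f_closed.
exists (2 * D * n%:R / r0).
  by apply: divr_ge0 (ltW r00); apply: mulr_ge0 => //; lra.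
move=> v r dv fvr e e0.
have := gauge_ge0 gM fvr; rewrite le_eqVlt => /orP[/eqP r_0|r_gt0].
  exists 0; first by rewrite -r_0 mulr0; exact: (gauge0 gN).
  by rewrite linear0 subr0; apply: (gauge_le gM fvr); rewrite -r_0 ltW.
pose t := r0 / r; have t0 : 0 < t by exact: divr_gt0.
pose e' := t * e / (2 * D); have e'0 : 0 < e' by apply: divr_gt0; [exact: mulr_gt0|lra].
have dtv : gauge_dom N (of_real t *: v) by exact: gauge_domZ gN _ _ dv.
have [||v1 Nv1 Mv1] := ballP (of_real t *: v + v0) _ _ _ e'0.
- exact: gauge_domD gN _ _ dtv dv0.
- rewrite linearD addrK linearZ; have := gaugeZ gM (of_real t) fvr.
  by rewrite modulus_of_real ?ltW // divfK // gt_eqF.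
have [|v2 Nv2 Mv2] := ballP v0 dv0 _ _ e'0.
  by rewrite subrr; apply: (gauge_le gM (gauge0 gM)); exact: ltW.
have tV : modulus (of_real t^-1 : K) = t^-1 by rewrite modulus_of_real // invr_ge0 ltW.
have tK w : of_real t^-1 *: (of_real t *: w) = w :> W.
  by rewrite scalerA -of_realM mulVf ?gt_eqF // of_real1 scale1r.
exists (of_real t^-1 *: (v1 - v2)).
  have := gaugeZ gN (of_real t^-1) (gaugeB gN Nv1 Nv2); rewrite tV; congr (N _ _).
  by rewrite /t; field; rewrite !gt_eqF.
have := gaugeZ gM (of_real t^-1) (gaugeB gM Mv1 Mv2); rewrite tV.
rewrite (_ : _ - _ - _ = of_real t *: f v - f (v1 - v2)); last first.
  rewrite linearD linearZ [f (v1 - v2)]linearB /= !opprB [in LHS]addrAC addrACA subrr addr0.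
  by rewrite addrA.
rewrite scalerBr tK => Mw; rewrite linearZ /=; move: Mw; congr (M _ _).
by rewrite /e'; field; rewrite gt_eqF //=; lra.
Qed.

(** The usual successive approximation: the preimage is [v] minus the limit of
    vectors whose images tend to [0]. *)
Lemma closed_range_open : gauge_complete D M -> closed_range -> open_onto_range.
Proof.
move=> cM f_closed; have D1' := D1.
have [C C0 CP] := range_approximated cM f_closed.
have [cf cf0 cfP] := f_bounded; have [c c0 cP] := cN.
exists (c * C); first exact: mulr_ge0.
move=> v r dv fvr; have := gauge_ge0 gM fvr.
rewrite le_eqVlt => /orP[/eqP r_0|r_gt0].
  exists 0; first by rewrite -r_0 mulr0; exact: (gauge0 gN).
  move=> e e0; rewrite linear0 subr0; apply: (gauge_le gM fvr).
  by rewrite -r_0 ltW.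
pose rho k := r / (2 * D) ^+ k.
have rho0 k : 0 < rho k by rewrite divr_gt0 // exprn_gt0 //; lra.
have rhog : geometric D rho by exact: geometric_powers (ltW r_gt0).
have step (p : nat * V) : exists q : V, gauge_dom N p.2 -> M (f p.2) (rho p.1) ->
    N (q - p.2) (C * rho p.1) /\ M (f q) (rho p.1.+1).
  have [[dp fp]|np] := pselect (gauge_dom N p.2 /\ M (f p.2) (rho p.1)); last first.
    by exists 0 => dp fp; case: np.
  have [u Nu Mu] := CP _ _ dp fp _ (rho0 p.1.+1).
  exists (p.2 - u) => _ _; rewrite linearB; split=> //.
  by apply: (gauge_distC gN); rewrite subKr.
have [next nextP] := choice step.
pose x := fix x n := if n is m.+1 then next (m, x m) else v.
have xP n : gauge_dom N (x n) /\ M (f (x n)) (rho n).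
  elim: n => [|n [IH1 IH2]] /=; first by split=> //; rewrite /rho expr0 divr1.
  have [/= Nx Mx] := nextP (n, x n) IH1 IH2; split=> //.
  rewrite -[next _](subrK (x n)); apply: (gauge_domD gN) => //.
  by exists (C * rho n).
have xS n := nextP (n, x n) (xP n).1 (xP n).2.
have [|l lP] := cP x _ (geometricZ C0 rhog); first by move=> n; have [] := xS n.
exists (v - l).
  have := lP 0%N; rewrite /rho expr0 divr1 mulrA => h.
  exact: (gauge_distC gN).
rewrite linearB subKr.
apply: (gauge_null_limit gM D1 (c := D * (cf * (c * C) + 1)) rhog).
  by apply: mulr_ge0; [lra|apply: addr_ge0 => //; do !apply: mulr_ge0].
move=> k; rewrite -[l](subrK (x k)) linearD.
have := gaugeD gM (cfP _ _ (lP k)) (xP k).2; congr (M _ _); ring.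
Qed.

(** Let the images of [v k] tend to [w] geometrically. Each difference
    [v k.+1 - v k] can be replaced by a vector with the same image and of a size
    comparable to that image; the sum of the new differences then converges. *)
Lemma open_closed_range : open_onto_range -> closed_range.
Proof.
move=> [C C0 CP] w wP; have D1' := D1.
have [cf cf0 cfP] := f_bounded; have [c c0 cP] := cN.
pose rho k := 1 / (2 * D) ^+ k : R.
have rho0 k : 0 < rho k by rewrite divr_gt0 // exprn_gt0 //; lra.
have rhog : geometric D rho by exact: geometric_powers.
have /choice[v vP] k : exists v, gauge_dom N v /\ M (w - f v) (rho k).
  by have [v dv Mv] := wP _ (rho0 k); exists v.
have rhoS k : rho k.+1 <= rho k.
  by apply: le_trans (rhog.2 k) _; rewrite ler_pdivrMr; have := rho0 k; nra.
have /choice[u uP] k : exists u, N u (C * (2 * D * rho k)) /\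
    gauge_null M (f (v k.+1 - v k) - f u).
  have [||u Nu Mu] := CP (v k.+1 - v k) (2 * D * rho k).
  - exact: gauge_domB gN _ _ (vP _).1 (vP _).1.
  - rewrite linearB.
    apply: (gauge_le gM (gauge_tri gM (gauge_distC gM (vP k.+1).2) (vP k).2)).
    by rewrite -mulrA mulrCA ler_wpM2l; [|lra|have := rhoS k; lra].
  - by exists u.
pose x := fix x n := if n is m.+1 then x m + u m else v 0%N.
have xg : geometric D (fun k => C * (2 * D) * rho k).
  by apply: geometricZ rhog; apply: mulr_ge0 => //; lra.
have [|l lP] := cP x _ xg.
  by move=> n /=; rewrite addrC addKr -mulrA; exact: (uP n).1.
have xv k : gauge_null M (f (v k) - f (x k)).
  elim: k => [|k IH] /=; first 
    by rewrite subrr => e e0; apply: (gauge_le gM (gauge0 gM)); exact: ltW.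
  have := gauge_nullD gM D1 IH (uP k).2.
  by congr gauge_null; 
    rewrite [f (_ - v k)]linearB [f (_ + u k)]linearD opprD addrACA [f (v k) + _]addrC subrK.
exists l.
  rewrite -[l](subrK (v 0%N)); apply: (gauge_domD gN) (vP 0%N).1.
  by eexists; exact: lP 0%N.
apply: (gauge_null_limit gM D1
    (c := D * (D * (1 + 1) + cf * (c * (C * (2 * D))))) rhog).
  by apply: mulr_ge0; [lra|apply: addr_ge0; [nra|do !apply: mulr_ge0 => //; lra]].
move=> k.
have h1 := gauge_tri gM (vP k).2 (xv k _ (rho0 k)).
have h2 : M (f (x k) - f l) (cf * (c * (C * (2 * D) * rho k))).
  by rewrite -linearB; apply: cfP; apply: (gauge_distC gN); exact: lP.
have := gauge_tri gM h1 h2; congr (M _ _); ring.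
Qed.

End OpenMapping.

(** * Quasi-normed spaces *)

Section QuasiNormed.
Context (R : realType) (s : scalars).
Local Notation K := (Defs.scalar R s).

Lemma qnorm_triangle_ex (V : quasiNormedType R s) :
  exists D : R, 1 <= D /\ forall x y : V, qnorm (x + y) <= D * (qnorm x + qnorm y).
Proof.
have [D DP] := @qnormD_ex _ _ V; exists (Num.max 1 D); rewrite le_max lexx; split=> //.
move=> x y; apply: le_trans (DP x y) _; apply: ler_wpM2r; last by rewrite le_max lexx orbT.
by apply: addr_ge0; exact: qnorm_ge0.
Qed.

Definition qtri (V : quasiNormedType R s) : R := sval (cid (qnorm_triangle_ex V)).

Definition qgauge (V : quasiNormedType R s) (v : V) (r : R) : Prop := qnorm v <= r.

Section Theory.
Context (V : quasiNormedType R s).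
Implicit Types x y : V.

Lemma qtri_ge1 : 1 <= qtri V.
Proof. by rewrite /qtri; case: cid => D []. Qed.

Lemma qnormD x y : qnorm (x + y) <= qtri V * (qnorm x + qnorm y).
Proof. by move: x y; rewrite /qtri; case: cid => D []. Qed.

Lemma qnorm0 : qnorm (0 : V) = 0.
Proof. by rewrite -(scale0r 0) qnormZ modulus0 mul0r. Qed.

Lemma qnormN x : qnorm (- x) = qnorm x.
Proof. by rewrite -scaleN1r qnormZ modulusN modulus1 mul1r. Qed.

Lemma qnorm_distC x y : qnorm (x - y) = qnorm (y - x).
Proof. by rewrite -qnormN opprB. Qed.

Lemma qnorm_gt0 x : x != 0 -> 0 < qnorm x.
Proof.
by move=> x0; rewrite lt_neqAle qnorm_ge0 andbT; apply: contraNneq x0 => /esym/qnorm_eq0 ->.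
Qed.

Lemma qgauge_gauge D : qtri V <= D -> gauge D (@qgauge V).
Proof.
move=> VD; have D1 := le_trans qtri_ge1 VD; split; rewrite /qgauge.
- by move=> v r; apply: le_trans; exact: qnorm_ge0.
- by move=> v r t; exact: le_trans.
- by rewrite qnorm0.
- move=> u v r t ur vt; apply: le_trans (qnormD u v) _; apply: ler_pM => //.
  + by apply: le_trans qtri_ge1.
  + by apply: addr_ge0; exact: qnorm_ge0.
  + exact: lerD.
- by move=> a v r vr; rewrite qnormZ; apply: ler_wpM2l => //; exact: modulus_ge0.
Qed.

Lemma qgauge_null x : gauge_null (@qgauge V) x -> x = 0.
Proof.
move=> x0; apply: qnorm_eq0; apply/eqP; rewrite eq_le qnorm_ge0 andbT.
by apply/ler_addgt0Pr => e e0; rewrite add0r; exact: x0.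
Qed.

Lemma nbhs_qnormP x (A : set V) :
  nbhs x A <-> exists2 e : R, 0 < e & forall y, qnorm (y - x) < e -> A y.
Proof.
rewrite -nbhs_entourageE qnorm_entourageE; split.
  move=> [E [e e0 eE] EA]; exists e => // y yx; apply: EA.
  by apply/mem_set; apply: eE => /=; rewrite qnorm_distC.
move=> [e e0 eA]; exists [set xy : V * V | qnorm (xy.1 - xy.2) < e]; first by exists e.
by move=> y /set_mem /=; rewrite qnorm_distC; exact: eA.
Qed.

End Theory.

(** By homogeneity a bound on a ball gives a bound everywhere. *)
Lemma homogeneous_on_bound (V W : quasiNormedType R s) (P : set V) (f : V -> W) (d c : R) :
  (forall (a : K) x, P x -> P (a *: x) /\ f (a *: x) = a *: f x) -> 0 < d ->
  (forall x, P x -> qnorm x <= d -> qnorm (f x) <= c) ->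
  forall x, P x -> qnorm (f x) <= c / d * qnorm x.
Proof.
move=> fP d0 fc x Px; have [->|x0] := eqVneq x 0.
  by rewrite -(scale0r x) (fP 0 x Px).2 !scale0r !qnorm0 mulr0.
have n0 := qnorm_gt0 x0; pose t : R := d / qnorm x; have t0 : 0 < t by exact: divr_gt0.
have [Ptx ftx] := fP (of_real t) x Px.
have tx : t * qnorm x = d by rewrite divfK ?gt_eqF.
have := fc _ Ptx; rewrite ftx !qnormZ (modulus_of_real _ (ltW t0)) tx.
move=> /(_ (lexx d)); rewrite -ler_pdivlMl // => /le_trans; apply.
by rewrite /t invf_div [leLHS]mulrC mulrA mulrAC.
Qed.

Lemma homogeneous_bound (V W : quasiNormedType R s) (f : V -> W) (d c : R) :
  homogeneous f -> 0 < d ->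
  (forall x, qnorm x <= d -> qnorm (f x) <= c) ->
  forall x, qnorm (f x) <= c / d * qnorm x.
Proof.
move=> fh d0 fc x; apply: (@homogeneous_on_bound _ _ setT) => // y _; exact: fc.
Qed.

(** A map which is only linear on a subspace, as the morphism in the definition
    of a Baer sum is, still satisfies the equivalence of continuity with
    boundedness. *)
Lemma linear_on_qnorm_continuous (V W : quasiNormedType R s) (P : set V) (f : V -> W) :
  (forall (a : K) p q, P p -> P q -> P (a *: p + q) /\ f (a *: p + q) = a *: f p + f q) ->
  (exists2 C, 0 <= C & forall x, P x -> qnorm (f x) <= C * qnorm x) ->
  {within P, continuous f}.
Proof.
move=> fP [C C0 CP]; apply/subspace_continuousP => x Px A /nbhs_qnormP[e e0 eA].
apply/nbhs_qnormP; exists (e / (C + 1)); first by apply: divr_gt0 => //; lra.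
move=> y yx Py; apply: eA => /=.
have [Pyx fyx] := fP (-1) x y Px Py; rewrite !scaleN1r in Pyx fyx.
rewrite addrC -fyx; apply: le_lt_trans (CP _ Pyx) _; rewrite addrC.
apply: le_lt_trans (ler_wpM2r (qnorm_ge0 _) (_ : _ <= C + 1)) _; first by lra.
by rewrite -ltr_pdivlMl ?[_^-1 * _]mulrC //; lra.
Qed.

Lemma linear_on_continuous_qnorm (V W : quasiNormedType R s) (P : set V) (f : V -> W) :
  P 0 ->
  (forall (a : K) p q, P p -> P q -> P (a *: p + q) /\ f (a *: p + q) = a *: f p + f q) ->
  {within P, continuous f} ->
  exists2 C, 0 <= C & forall x, P x -> qnorm (f x) <= C * qnorm x.
Proof.
move=> P0 fP /subspace_continuousP fc.
have f0 : f 0 = 0.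
  have [_] := fP 1 0 0 P0 P0; rewrite !scale1r addr0 => /eqP.
  by rewrite -subr_eq subrr => /eqP <-.
have : nbhs (f 0) [set y | qnorm (y - f 0) < 1] by apply/nbhs_qnormP; exists 1.
move=> /(fc 0 P0)/nbhs_qnormP[e e0 eP].
exists (1 / (e / 2)); first by apply: divr_ge0 => //; apply: divr_ge0 => //; exact: ltW.
apply: homogeneous_on_bound; [|by apply: divr_gt0|].
  move=> a x Px; have [Pax fax] := fP a x 0 Px P0.
  by rewrite addr0 in Pax fax; rewrite fax f0 addr0.
move=> x Px xe; have xe' : qnorm x < e.
  by apply: le_lt_trans xe _; rewrite ltr_pdivrMr //; lra.
by have := eP x; rewrite /= f0 !subr0 => /(_ xe' Px)/ltW.
Qed.

Lemma linear_qnorm_continuous (V W : quasiNormedType R s) (f : {linear V -> W}) :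
  (exists2 C, 0 <= C & forall x, qnorm (f x) <= C * qnorm x) -> continuous f.
Proof.
move=> [C C0 CP]; apply/continuous_subspace_setT.
apply: linear_on_qnorm_continuous; last by exists C => // x _; exact: CP.
by move=> a p q _ _; rewrite linearP.
Qed.

Lemma linear_continuous_qnorm (V W : quasiNormedType R s) (f : {linear V -> W}) :
  continuous f -> exists2 C, 0 <= C & forall x, qnorm (f x) <= C * qnorm x.
Proof.
move=> fc.
have [//|||C C0 CP] := @linear_on_continuous_qnorm V W setT f.
- by move=> a p q _ _; rewrite linearP.
- exact: continuous_subspaceT.
- by exists C => // x; exact: CP.
Qed.

Lemma qgauge_complete (V : quasiBanachType R s) D : qtri V <= D ->
  gauge_complete D (@qgauge V).
Proof.
move=> VD; have D1 := le_trans (qtri_ge1 V) VD; have gV := qgauge_gauge VD.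
exists (D * (2 * D)); first by apply: mulr_ge0; lra.
move=> v r rg vr; have vk := gauge_geometric gV D1 rg vr.
have [|l lP] := @qcomplete _ _ V (v @ \oo) _.
  move=> A; rewrite qnorm_entourageE => -[e e0 eA].
  have c0 : 0 <= D * (2 * (2 * D)) by apply: mulr_ge0; lra.
  have e20 : 0 < e / 2 by exact: divr_gt0.
  have [k _ rk] := geometric_small D1 (geometricZ c0 rg) e20 0.
  pose U := [set y | qnorm (y - v k) <= 2 * D * r k]; exists (U, U).
    by split; rewrite /U; exists k => // n /= kn; rewrite -(subnK kn); exact: vk.
  move=> [x y] [/= xk yk]; apply: eA => /=.
  have := gauge_tri gV (xk : qgauge _ _) (gauge_distC gV (yk : qgauge _ _)).
  by rewrite /qgauge => h; apply: (le_lt_trans h); lra.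
exists l => k; rewrite /qgauge; apply/ler_addgt0Pr => e e0.
have eD : 0 < e / D by apply: divr_gt0 => //; lra.
have : (v @ \oo) [set y | qnorm (y - l) < e / D].
  by apply: lP; apply/nbhs_qnormP; exists (e / D).
move=> [n _ /(_ (maxn n k) (leq_maxl _ _))] /= /ltW vl.
have := vk (maxn n k - k)%N k; rewrite subnK ?leq_maxr // => vnk.
have := gauge_tri gV (gauge_distC gV (vl : qgauge _ _)) vnk.
have De : D * (e / D) = e by field; rewrite gt_eqF //; lra.
by rewrite /qgauge mulrDr De => h; apply: (le_trans h); lra.
Qed.

End QuasiNormed.

(** * Bounded and quasilinear maps *)

Section Maps.
Context (R : realType) (s : scalars) (X Y : quasiBanachType R s).
Local Notation K := (Defs.scalar R s).
Implicit Types F G : X -> Y.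

Definition bgauge F (r : R) : Prop :=
  [/\ 0 <= r, homogeneous F & forall x, qnorm (F x) <= r * qnorm x].

Definition defect F (x y : X) : Y := F (x + y) - F x - F y.

Definition dgauge F (r : R) : Prop :=
  [/\ 0 <= r, homogeneous F
    & forall x y, qnorm (defect F x y) <= r * (qnorm x + qnorm y)].

Definition mtri : R := Num.max (qtri X) (qtri Y).

Lemma mtriX : qtri X <= mtri. Proof. by rewrite le_max lexx. Qed.
Lemma mtriY : qtri Y <= mtri. Proof. by rewrite le_max lexx orbT. Qed.
Lemma mtri_ge1 : 1 <= mtri. Proof. exact: le_trans (qtri_ge1 X) mtriX. Qed.

Let D := mtri.
Let gX : gauge D (@qgauge R s X) := qgauge_gauge mtriX.
Let gY : gauge D (@qgauge R s Y) := qgauge_gauge mtriY.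

Lemma homogeneous_linear (L : {linear X -> Y}) : homogeneous L.
Proof. by move=> a x; rewrite linearZ. Qed.

Lemma homogeneousD F G : homogeneous F -> homogeneous G -> homogeneous (F + G).
Proof. by move=> Fh Gh a x; rewrite !addrfctE Fh Gh scalerDr. Qed.

Lemma homogeneousZ a F : homogeneous F -> homogeneous (a *: F).
Proof. by move=> Fh b x; rewrite !scalrfctE Fh !scalerA mulrC. Qed.

Lemma defectD F G x y : defect (F + G) x y = defect F x y + defect G x y.
Proof. by rewrite /defect !addrfctE !opprD (addrACA (F (x + y))) (addrACA (_ - _)). Qed.

Lemma defectZ a F x y : defect (a *: F) x y = a *: defect F x y.
Proof. by rewrite /defect !scalrfctE !scalerBr. Qed.

Lemma defect_linear (L : {linear X -> Y}) x y : defect L x y = 0.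
Proof. by rewrite /defect raddfD (addrC (L x)) addrK subrr. Qed.

Lemma homogeneous0 F : homogeneous F -> F 0 = 0.
Proof. by move=> Fh; rewrite -(scale0r 0) Fh scale0r. Qed.

Lemma bgauge_gauge : gauge D bgauge.
Proof.
have D1 := mtri_ge1; split.
- by move=> F r [].
- move=> F r t [r0 Fh Fr] rt; split=> //; first exact: le_trans rt.
  by move=> x; apply: le_trans (Fr x) _; apply: ler_wpM2r => //; exact: qnorm_ge0.
- split=> // [a x|x]; first by rewrite scaler0.
  by rewrite qnorm0 mul0r.
- move=> F G r t [r0 Fh Fr] [t0 Gh Gt]; split; last first.
  + move=> x; have := gaugeD gY (Fr x) (Gt x).
    by rewrite /qgauge -mulrDl mulrA.
  + exact: homogeneousD.
  + by apply: mulr_ge0; [exact: le_trans D1|exact: addr_ge0].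
- move=> a F r [r0 Fh Fr]; split.
  + by apply: mulr_ge0 => //; exact: modulus_ge0.
  + exact: homogeneousZ.
  + by move=> x; rewrite qnormZ -mulrA; apply: ler_wpM2l => //; exact: modulus_ge0.
Qed.

Lemma dgauge_gauge : gauge D dgauge.
Proof.
have D1 := mtri_ge1; split.
- by move=> F r [].
- move=> F r t [r0 Fh Fr] rt; split=> //; first exact: le_trans rt.
  move=> x y; apply: le_trans (Fr x y) _; apply: ler_wpM2r => //.
  by apply: addr_ge0; exact: qnorm_ge0.
- split=> // [a x|x y]; first by rewrite scaler0.
  by rewrite /defect !subr0 qnorm0 mul0r.
- move=> F G r t [r0 Fh Fr] [t0 Gh Gt]; split; last first.
  + move=> x y; have := gaugeD gY (Fr x y) (Gt x y).
    by rewrite /qgauge -mulrDl mulrA defectD.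
  + exact: homogeneousD.
  + by apply: mulr_ge0; [exact: le_trans D1|exact: addr_ge0].
- move=> a F r [r0 Fh Fr]; split.
  + by apply: mulr_ge0 => //; exact: modulus_ge0.
  + exact: homogeneousZ.
  + move=> x y; rewrite defectZ qnormZ -mulrA.
    by apply: ler_wpM2l => //; exact: modulus_ge0.
Qed.

Lemma dgauge_linear (L : {linear X -> Y}) r : 0 <= r -> dgauge L r.
Proof.
move=> r0; split=> // [|x y]; first exact: homogeneous_linear.
by rewrite defect_linear qnorm0; apply: mulr_ge0 => //; apply: addr_ge0; exact: qnorm_ge0.
Qed.

Lemma dgauge_subl F (L : {linear X -> Y}) r : dgauge F r -> dgauge (F - (L : X -> Y)) r.
Proof.
move=> [r0 Fh Fr]; split=> // [|x y].
  apply: homogeneousD => // a x; rewrite !opprfctE linearZ /=.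
  by rewrite scalerN.
have -> : F - (L : X -> Y) = F + (-1) *: (L : X -> Y) by rewrite scaleN1r.
by rewrite defectD defectZ defect_linear scaler0 addr0.
Qed.

Lemma dgauge_null_linear F : gauge_null dgauge F ->
  exists L : {linear X -> Y}, F = L.
Proof.
move=> F0; have [_ Fh _] := F0 1 ltr01.
have [|L LF] := @linear_map_of _ X Y F; last by exists L; apply/funext => x; rewrite LF.
move=> a x y; rewrite -Fh; apply/eqP; rewrite addrC -subr_eq -subr_eq0 -/(defect _ _ _).
apply/eqP; apply: qgauge_null => e e0.
pose n := qnorm (a *: x) + qnorm y + 1.
have n0 : 0 < n by rewrite ltr_wpDl // addr_ge0 // qnorm_ge0.
have [_ _ Fe] := F0 _ (divr_gt0 e0 n0).
apply: le_trans (Fe _ _) _; rewrite mulrAC ler_pdivrMr //.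
by apply: ler_wpM2l; [exact: ltW|rewrite lerDl].
Qed.

Lemma bgauge_dgauge F r : bgauge F r -> dgauge F (D * (D * (D + 1) + 1) * r).
Proof.
have D1 : 1 <= D := mtri_ge1.
move=> [r0 Fh Fr]; split=> // [|x y]; first by apply: mulr_ge0 => //; nra.
have x0 := qnorm_ge0 x; have y0 := qnorm_ge0 y.
have hxy : qgauge (F (x + y)) (r * (D * (qnorm x + qnorm y))).
  apply: le_trans (Fr _) _; apply: ler_wpM2l => //; 
  exact: (gaugeD gX (lexx _ : qgauge x _) (lexx _ : qgauge y _)).
have := gaugeB gY (gaugeB gY hxy (Fr x)) (Fr y).
move=> /le_trans; apply.
have h1 : r * qnorm x <= r * (qnorm x + qnorm y) by apply: ler_wpM2l => //; lra.
have h2 : r * qnorm y <= r * (qnorm x + qnorm y) by apply: ler_wpM2l => //; lra.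
have D0 : 0 <= D by lra.
rewrite -!mulrA; apply: ler_wpM2l => //.
rewrite mulrDl mul1r; apply: lerD => //; rewrite -mulrA; apply: ler_wpM2l => //.
by rewrite mulrDl mul1r mulrCA; apply: lerD.
Qed.

(** Either bound passes to pointwise limits, even if the approximating map
    depends on the points, at the price of the constant of [Y]. *)
Definition approximable (P : (X -> Y) -> Prop) F : Prop :=
  forall x y z e, 0 < e -> exists2 G, P G &
    [/\ qnorm (F x - G x) <= e, qnorm (F y - G y) <= e & qnorm (F z - G z) <= e].

Lemma approximable_homogeneous (P : (X -> Y) -> Prop) F :
  (forall G, P G -> homogeneous G) -> approximable P F -> homogeneous F.
Proof.
have D1 : 1 <= D := mtri_ge1.
move=> Ph FP a x; apply/eqP; rewrite -subr_eq0; apply/eqP; apply: qgauge_null => e e0.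
have a0 := modulus_ge0 a; have Da : 0 < D * (1 + modulus a) by nra.
have [G PG [Gax Gx _]] := FP (a *: x) x x _ (divr_gt0 e0 Da).
have := gaugeZ gY a (gauge_distC gY (Gx : qgauge _ _)).
rewrite scalerBr -(Ph G PG) => aGx.
apply: (gauge_le gY (gauge_tri gY (Gax : qgauge _ _) aGx)).
rewrite le_eqVlt; apply/orP; left; apply/eqP.
by field; rewrite !gt_eqF //; lra.
Qed.

Lemma approximable_bgauge F r : approximable (bgauge^~ r) F -> bgauge F (D * r).
Proof.
have D1 : 1 <= D := mtri_ge1; move=> FP.
have [_ [r0 _ _] _] := FP 0 0 0 1 ltr01; split; first by apply: mulr_ge0 => //; lra.
  by apply: approximable_homogeneous FP => G [].
move=> x; apply/ler_addgt0Pr => e e0.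
have [|G [_ _ Gr] [Gx _ _]] := FP x x x (e / D); first by apply: divr_gt0 => //; lra.
have := gaugeD gY (Gx : qgauge _ _) (Gr x); rewrite subrK => /le_trans; apply.
rewrite le_eqVlt; apply/orP; left; apply/eqP.
by field; rewrite !gt_eqF //; lra.
Qed.

Lemma approximable_dgauge F r : approximable (dgauge^~ r) F -> dgauge F (D * r).
Proof.
have D1 : 1 <= D := mtri_ge1; move=> FP.
have [_ [r0 _ _] _] := FP 0 0 0 1 ltr01; split; first by apply: mulr_ge0 => //; lra.
  by apply: approximable_homogeneous FP => G [].
move=> x y; apply/ler_addgt0Pr => e e0.
pose c := D * (D * (D * (1 + 1) + 1)).
have c0 : 0 < c by rewrite /c; nra.
have [|G [_ _ Gr] [Gxy Gx Gy]] := FP (x + y) x y (e / c); first exact: divr_gt0.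
have FG := gaugeB gY (gaugeB gY (Gxy : qgauge _ _) Gx) Gy.
have := gaugeD gY FG (Gr x y).
rewrite -[_ - (F y - G y)]/(defect (F - G) x y) -defectD subrK.
move=> /le_trans; apply.
rewrite le_eqVlt; apply/orP; left; apply/eqP.
by rewrite /c; field; rewrite !gt_eqF //; lra.
Qed.

End Maps.

(** * Completeness of the space of quasilinear maps *)

Section MapsComplete.
Context (R : realType) (s : scalars) (X Y : quasiBanachType R s).
Local Notation K := (Defs.scalar R s).
Implicit Types F G : X -> Y.

Let D : R := mtri X Y.
Let gX : gauge D (@qgauge R s X) := qgauge_gauge (mtriX X Y).
Let gY : gauge D (@qgauge R s Y) := qgauge_gauge (mtriY X Y).

Lemma pointwise_limit (v : nat -> X -> Y) (w : X -> R) r : geometric D r ->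
  (forall x, 0 <= w x) ->
  (forall k x, qnorm (v k.+1 x - v k x) <= w x * r k) ->
  exists F, forall x e, 0 < e -> forall n, exists2 k, (n <= k)%N &
    forall m, (k <= m)%N -> qnorm (F x - v m x) <= e.
Proof.
have D1 : 1 <= D := mtri_ge1 X Y.
move=> rg w0 vr; have [c c0 cP] := qgauge_complete (mtriY X Y).
have /choice[F FP] x : exists l, forall k, qnorm (l - v k x) <= c * (w x * r k).
  exact: (cP (v^~ x) _ (geometricZ (w0 x) rg) (vr^~ x)).
exists F => x e e0 n.
have wg := geometricZ c0 (geometricZ (w0 x) rg).
have [k nk ke] := geometric_small D1 wg e0 n.
exists k => // m km; apply: le_trans (FP x m) (le_trans _ ke).
rewrite -(subnK km); elim: (m - k)%N => [|i IH]; first by rewrite add0n.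
rewrite addSn; apply: le_trans (wg.2 _) _; apply: le_trans IH.
by rewrite ler_pdivrMr; last lra; have := wg.1 (i + k)%N; nra.
Qed.

Lemma bgauge_complete : gauge_complete D (@bgauge R s X Y).
Proof.
have D1 : 1 <= D := mtri_ge1 X Y.
exists (D * (2 * D)); first by nra.
move=> v r rg vr.
have [|k x|F FP] := @pointwise_limit v (@qnorm R s X) r rg.
- exact: qnorm_ge0.
- by have [_ _] := vr k; rewrite mulrC; exact.
exists F => k; rewrite -mulrA; apply: approximable_bgauge => x y z e e0.
have [i ki iP] := FP x e e0 k; have [j kj jP] := FP y e e0 k.
have [l kl lP] := FP z e e0 k; pose n := maxn i (maxn j l).
have kn : (k <= n)%N by rewrite leq_max ki.
exists (v n - v k).
  have := gauge_geometric (bgauge_gauge X Y) D1 rg vr (n - k)%N k.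
  by rewrite subnK.
rewrite !addrfctE !opprfctE; split; rewrite opprB addrA subrK.
- by apply: iP; rewrite leq_maxl.
- by apply: jP; rewrite !leq_max leqnn orbT.
- by apply: lP; rewrite !leq_max leqnn !orbT.
Qed.

(** By induction on the number of summands; the point is that the constant does
    not depend on [F]. *)
Lemma dgauge_sum (l : seq X) (c : X -> K) : exists2 A : R, 0 <= A &
  forall F q, dgauge F q ->
    qnorm (F (\sum_(z <- l) c z *: z) - \sum_(z <- l) c z *: F z) <= A * q.
Proof.
have D1 : 1 <= D := mtri_ge1 X Y.
elim: l => [|z l [A A0 AP]].
  exists 0 => // F q [_ Fh _]; rewrite !big_nil (homogeneous0 Fh) subrr qnorm0.
  by rewrite mul0r.
set S := \sum_(z <- l) c z *: z in AP *.
exists (D * ((qnorm (c z *: z) + qnorm S) + A)).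
  apply: mulr_ge0; first lra.
  by do 2?apply: addr_ge0 => //; exact: qnorm_ge0.
move=> F q Fq; have [q0 Fh FP] := Fq; rewrite !big_cons -/S -Fh.
have := gaugeD gY (FP (c z *: z) S) (AP F q Fq).
rewrite /defect addrA subrK opprD addrA => /le_trans; apply.
by rewrite le_eqVlt; apply/orP; left; apply/eqP; ring.
Qed.

(** A linear map can be prescribed on a Hamel basis of [X]. A quasilinear map
    vanishing there is controlled at each point by its constant alone, since the
    point is a fixed finite combination of basis vectors.  Here the basis is
    replaced by a linear choice, for each point, of a formal combination of
    points that sums to it. *)
Lemma dgauge_linear_part : exists2 w : X -> R, forall x, 0 <= w x &
  forall F q, dgauge F q ->
    exists L : {linear X -> Y}, forall x, qnorm (F x - L x) <= w x * q.
Proof.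
have [T TE] := linear_map_of (@fglift_linear K X X id).
have [x|S SK] := linear_section (T := T).
  by exists (<< x >>)%R; rewrite TE liftU scale1r.
have /choice[w wP] x : exists A : R, 0 <= A /\ forall F q, dgauge F q ->
    qnorm (F x - fglift F (S x)) <= A * q.
  have [A A0 AP] := dgauge_sum (dom (S x)) (fun z => @coeff K X z (S x)).
  exists A; split=> // F q /AP.
  have liftE (V : lmodType K) (f : X -> V) (E : {freeg X / K}) :
      fglift f E = \sum_(z <- dom E) coeff z E *: f z.
    have [g gE] := linear_map_of (@fglift_linear K X V f).
    rewrite -gE -{1}(freeg_sumE E) linear_sum; apply: eq_bigr => z _.
    by rewrite gE liftU.
  by rewrite liftE -(liftE X id) -TE SK.
exists w => [x|F q Fq]; first exact: (wP x).1.
have [L LE] := linear_map_of (@fglift_linear K X Y F).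
have [|LS LSE] := @linear_map_of _ X Y (L \o S).
  by move=> a x y /=; rewrite !linearP.
by exists LS => x; rewrite LSE /= LE; exact: (wP x).2.
Qed.

(** Completeness modulo linear maps: a sequence which is Cauchy for the defect
    need not converge anywhere, but its linear parts may be subtracted. *)
Lemma dgauge_complete : gauge_complete D (@dgauge R s X Y).
Proof.
have D1 : 1 <= D := mtri_ge1 X Y.
exists (D * (2 * D)); first by nra.
move=> v r rg vr; have [w w0 wP] := dgauge_linear_part.
have /choice[L LP] k : exists L : {linear X -> Y}, forall x,
    qnorm ((v k.+1 - v k) x - L x) <= w x * r k by exact: wP (vr k).
(* [u k] differs from [v k] by a linear map only, but converges pointwise. *)
pose u := fix u k := if k is m.+1 then u m + ((v m.+1 - v m) - (L m : X -> Y)) else v 0%N.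
have uv k : exists Lk : {linear X -> Y}, u k = v k - (Lk : X -> Y).
  elim: k => [|k [Lk IH]] /=.
    have [|L0 L0E] := @linear_map_of _ X Y (fun=> 0).
      by move=> a x y; rewrite scaler0 addr0.
    exists L0; apply/funext => x; by rewrite !addrfctE !opprfctE L0E subr0.
  have [|L1 L1E] := @linear_map_of _ X Y ((Lk : X -> Y) + (L k : X -> Y)).
    by move=> a x y; rewrite !addrfctE !linearP scalerDr addrACA.
  exists L1; rewrite IH; apply/funext => x; rewrite !addrfctE !opprfctE L1E !addrfctE.
  by rewrite opprD addrACA [v k x + _]addrC subrK.
have [|k x|F FP] := @pointwise_limit u w r rg; first exact: w0.
  have -> : u k.+1 x = u k x + ((v k.+1 - v k) x - L k x) by [].
  by rewrite addrC addKr; exact: LP.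
exists F => k; rewrite -mulrA; apply: approximable_dgauge => x y z e e0.
have [i ki iP] := FP x e e0 k; have [j kj jP] := FP y e e0 k.
have [l kl lP] := FP z e e0 k; pose n := maxn i (maxn j l).
have kn : (k <= n)%N by rewrite leq_max ki.
have [Ln LnE] := uv n.
exists (u n - v k).
  rewrite LnE addrAC; apply: dgauge_subl.
  have := gauge_geometric (dgauge_gauge X Y) D1 rg vr (n - k)%N k.
  by rewrite subnK.
rewrite !addrfctE !opprfctE; split; rewrite opprB addrA subrK.
- by apply: iP; rewrite leq_maxl.
- by apply: jP; rewrite !leq_max leqnn orbT.
- by apply: lP; rewrite !leq_max leqnn !orbT.
Qed.

(** Modulo the maps of zero defect, which are the linear ones, the range of the
    inclusion of the bounded homogeneous maps consists of the trivial maps. *)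
Definition trivial_maps_closed : Prop :=
  closed_range (@bgauge R s X Y) (@dgauge R s X Y) (@idfun (X -> Y)).

Lemma trivial_maps_closedP : trivial_maps_closed <->
  open_onto_range (@bgauge R s X Y) (@dgauge R s X Y) (@idfun (X -> Y)).
Proof.
have D1 : 1 <= D := mtri_ge1 X Y.
have bounded : exists2 c : R, 0 <= c & forall F r, bgauge F r -> dgauge F (c * r).
  exists (D * (D * (D + 1) + 1)); last exact: bgauge_dgauge.
  by nra.
split.
  exact: (closed_range_open (f := @idfun (X -> Y)) D1 (bgauge_gauge X Y) (dgauge_gauge X Y)
    bgauge_complete bounded dgauge_complete).
exact: (open_closed_range (f := @idfun (X -> Y)) D1 (bgauge_gauge X Y) (dgauge_gauge X Y)
    bgauge_complete bounded).
Qed.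

Lemma hnorm_le F r : homogeneous F -> 0 <= r ->
  (hnorm F <= r%:E)%E <-> bgauge F r.
Proof.
move=> Fh r0; split=> [Fr|[_ _ Fr]].
  split=> //; rewrite -[r]divr1; apply: homogeneous_bound => // x x1.
  by rewrite -lee_fin; apply: le_trans Fr; apply: ereal_sup_ubound; exists x.
apply: ge_ereal_sup => _ [x /= x1 <-]; rewrite lee_fin.
by apply: le_trans (Fr x) _; rewrite -[leRHS]mulr1; exact: ler_wpM2l.
Qed.

Lemma homogeneous_boundedP F : homogeneous_bounded F <-> gauge_dom (@bgauge R s X Y) F.
Proof.
split=> [[Fh]|[r [r0 Fh Fr]]].
  case E : (hnorm F) => [r| |] // _.
    exists (Num.max 0 r); apply/hnorm_le => //; first by rewrite le_max lexx.
    by rewrite E lee_fin le_max lexx orbT.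
  by exists 0; apply/hnorm_le => //; rewrite E leNye.
split=> //; apply: le_lt_trans (ltry r).
by apply/hnorm_le.
Qed.

Lemma quasilinearP F : quasilinear F <-> gauge_dom (@dgauge R s X Y) F.
Proof. by split=> [[Fh [q [q0 Fq]]]|[q [q0 Fh Fq]]]; [exists q|split=> //; exists q]. Qed.

Lemma quasilinearity_attained F : quasilinear F -> dgauge F (quasilinearity F).
Proof.
move=> [Fh Fq]; have lb : lbound (quasilinear_constants F) 0 by move=> q [].
split=> //; first exact: lb_le_inf.
move=> x y; have := addr_ge0 (qnorm_ge0 x) (qnorm_ge0 y).
rewrite le_eqVlt => /orP[/eqP n0|n0].
  by have [q [_ /(_ x y)]] := Fq; rewrite -n0 !mulr0.
rewrite -ler_pdivrMr //; apply: lb_le_inf => // q [_ /(_ x y)].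
by rewrite ler_pdivrMr.
Qed.

(** Replacing [F] by a bounded map with the same defect, of size at most [C]
    times that defect, amounts to approximating [F] by a linear map: the
    difference of the two bounded maps is linear. *)
Lemma K0_fin_numP : K0 X Y \is a fin_num <->
  open_onto_range (@bgauge R s X Y) (@dgauge R s X Y) (@idfun (X -> Y)).
Proof.
have gb := bgauge_gauge X Y; have gd := dgauge_gauge X Y.
split=> [K0fin|[C C0 CP]]; last first.
  rewrite ge0_fin_numE; last first.
    by apply: le_ereal_inf_tmp => _ [c [c0 _] <-]; rewrite lee_fin.
  apply: le_lt_trans (ltry C); apply: ereal_inf_lbound; exists C => //; split=> //.
  move=> F Fq /homogeneous_boundedP Fb.
  have FQ := quasilinearity_attained Fq; have Q0 := gauge_ge0 gd FQ.
  have [G Gb /dgauge_null_linear[L LE]] := CP F _ Fb FQ.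
  exists L; have -> : (F \- L)%R = G by rewrite -[RHS](subKr F) [F - G]LE.
  by apply/hnorm_le => //; [have [] := Gb|exact: mulr_ge0].
have [C [C0 CP]] : [set C : R | 0 <= C /\ forall F : X -> Y, quasilinear F ->
    homogeneous_bounded F -> exists L : {linear X -> Y},
    (hnorm (F \- L)%R <= (C * quasilinearity F)%R%:E)%E] !=set0.
  apply/set0P/eqP => E; move: K0fin.
  by rewrite /K0 E image_set0 ereal_inf0.
exists C => // F r Fb Fr.
have Fq : quasilinear F by apply/quasilinearP; exists r.
have [L] := CP F Fq ((homogeneous_boundedP F).2 Fb).
have QF := quasilinearity_attained Fq.
move=> /hnorm_le LF; exists (F - (L : X -> Y)).
  apply: (gauge_le gb (LF _ _)).
  - have [_ Fh _] := Fr; apply: homogeneousD => // a x.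
    by rewrite linearZ scalerN.
  - by apply: mulr_ge0 => //; exact: (gauge_ge0 gd QF).
  - apply: ler_wpM2l => //; apply: ge_inf; first by exists 0 => q [].
    by have [] := Fr.
by rewrite /= subKr => e e0; apply: dgauge_linear; exact: ltW.
Qed.

End MapsComplete.

(** * The topology induced by a semi-quasi-norm *)

(** The space [E] with its operations is given as the image under [q] of a
    submodule, the vectors of finite size, and its laws are inherited from there.
    The function [rho] and the gauge [g] bound each other only up to strictness,
    which does not affect the topology. *)
Section InducedTopology.
Context (R : realType) (s : scalars).
Local Notation K := (Defs.scalar R s).
Context (V : lmodType K) (D : R) (g : V -> R -> Prop).
Context (E : Type) (zero : E) (add : E -> E -> E) (scale : K -> E -> E).
Context (rho : E -> \bar R) (q : V -> E).
Hypotheses (D1 : 1 <= D) (gg : gauge D g).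
Hypothesis q_onto : forall x, exists2 v, gauge_dom g v & x = q v.
Hypothesis q0 : q 0 = zero.
Hypothesis qD : forall u v, gauge_dom g u -> gauge_dom g v ->
  q (u + v) = add (q u) (q v).
Hypothesis qZ : forall a v, gauge_dom g v -> q (a *: v) = scale a (q v).
Hypothesis rho_lt : forall v r, gauge_dom g v -> (rho (q v) < r%:E)%E -> g v r.
Hypothesis rho_le : forall v r, g v r -> (rho (q v) <= r%:E)%E.

Let domD := gauge_domD gg.
Let domB := gauge_domB gg.
Let domZ := gauge_domZ gg.
Let dom_of v r : g v r -> gauge_dom g v. Proof. by exists r. Qed.
Let dom0 : gauge_dom g 0. Proof. by exists 0; exact: (gauge0 gg). Qed.

Let q_congr a a' u : gauge_dom g a -> gauge_dom g a' -> gauge_dom g u ->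
  q a = q a' -> q (a + u) = q (a' + u).
Proof. by move=> da da' du aa'; rewrite !qD // aa'. Qed.

(** The topology of the semi-quasi-norm. *)
Definition gauge_open (U : E -> Prop) : Prop :=
  forall v, gauge_dom g v -> U (q v) ->
    exists2 e : R, 0 < e & forall u, g u e -> U (q (v + u)).

Lemma gauge_open_topology : is_topology gauge_open.
Proof.
split=> [v _ _|U1 U2 U1o U2o v dv [U1v U2v]|F Fo v dv [U FU Uv]].
- by exists 1.
- have [e e0 eU] := U1o v dv U1v; have [e' e'0 eU'] := U2o v dv U2v.
  exists (Num.min e e'); first by rewrite lt_min e0.
  move=> u gu; split; [apply: eU|apply: eU'].
    by apply: (gauge_le gg gu); rewrite ge_min lexx.
  by apply: (gauge_le gg gu); rewrite ge_min lexx orbT.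
- have [e e0 eU] := Fo U FU v dv Uv; exists e => // u gu; exists U => //.
  exact: eU.
Qed.

(** Balls need not be open; this is the interior of a ball. *)
Lemma gauge_open_ball v e : gauge_dom g v -> 0 < e -> exists U : E -> Prop,
  [/\ gauge_open U, U (q v) & forall x, U x -> exists2 u, g u e & x = q (v + u)].
Proof.
move=> dv e0; have D1' := D1.
exists (fun x => exists d w, [/\ 0 < d, gauge_dom g w, x = q w
  & forall u, g u d -> exists2 u', g u' e & q (w + u) = q (v + u')]).
split.
- move=> w dw [d [w' [d0 dw' ww' wP]]].
  have d2 : 0 < d / (2 * D) by apply: divr_gt0 => //; lra.
  exists (d / (2 * D)) => // u gu; exists (d / (2 * D)), (w' + u).
  split=> //; first by apply: domD => //; exact: dom_of gu.
    by apply: q_congr => //; exact: dom_of gu.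
  move=> u2 gu2; rewrite -addrA; apply: wP.
  have := gaugeD gg gu gu2; congr (g _ _).
  by field; rewrite gt_eqF //; lra.
- by exists e, v; split=> // u gu; exists u.
- move=> x [d [w [d0 dw -> wP]]]; have [|u gu] := wP 0.
    by apply: (gauge_le gg (gauge0 gg)); exact: ltW.
  by rewrite addr0 => ->; exists u.
Qed.

Lemma gauge_open_linear : linear_topology add scale gauge_open.
Proof.
have D1' := D1; split; first exact: gauge_open_topology.
- move=> x y U Uo; have [a da ->] := q_onto x; have [b db ->] := q_onto y.
  rewrite -qD // => Uab; have [e e0 eU] := Uo _ (domD da db) Uab.
  have e2 : 0 < e / (2 * D) by apply: divr_gt0 => //; lra.
  have [Va [Vao Va1 VaP]] := gauge_open_ball da e2.
  have [Vb [Vbo Vb1 VbP]] := gauge_open_ball db e2.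
  exists Va, Vb; split=> // x' y' /VaP[u gu ->] /VbP[u' gu' ->].
  have du := dom_of gu; have du' := dom_of gu'.
  rewrite -qD; [|exact: domD|exact: domD].
  rewrite addrACA; apply: eU; have := gaugeD gg gu gu'; congr (g _ _).
  by field; rewrite gt_eqF //; lra.
- move=> a x U Uo; have [v dv ->] := q_onto x; rewrite -qZ // => Uav.
  have [e e0 eU] := Uo _ (domZ a dv) Uav; have [r vr] := dv.
  have r0 := gauge_ge0 gg vr; have a0 := modulus_ge0 a.
  have c0 : 0 < 2 * D * (r + 1) by rewrite mulr_gt0 //; lra.
  have c'0 : 0 < 2 * D * (modulus a + 1) by rewrite mulr_gt0 //; lra.
  pose d := Num.min 1 (e / (2 * D * (r + 1))).
  have d0 : 0 < d by rewrite lt_min ltr01 divr_gt0.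
  pose h := e / (2 * D * (modulus a + 1)); have h0 : 0 < h by exact: divr_gt0.
  have [W [Wo W1 WP]] := gauge_open_ball dv h0.
  exists [set b | modulus (b - a) < d], W; split=> //; first exact: nbhs_scalar.
  move=> b y /= ba /WP[u gu ->]; have du := dom_of gu.
  rewrite -qZ; last exact: domD.
  have -> : b *: (v + u) = a *: v + ((b - a) *: v + b *: u).
    by rewrite scalerDr addrA -scalerDl [a + _]addrC subrK.
  apply: eU; apply: (gauge_le gg (gaugeD gg (gaugeZ gg (b - a) vr) (gaugeZ gg b gu))).
  have := ba; rewrite lt_min => /andP[ba1 ba2].
  have b1 : modulus b <= modulus a + 1.
    by have := modulusD (b - a) a; rewrite subrK; lra.
  have -> : e = D * (e / (2 * D) + e / (2 * D)) by field; rewrite gt_eqF //; lra.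
  apply: ler_wpM2l; first lra.
  have b0 := modulus_ge0 (b - a).
  apply: lerD.
    apply: (@le_trans _ _ (modulus (b - a) * (r + 1))); first by apply: ler_wpM2l => //; lra.
    have r1 : 0 < r + 1 by lra.
    rewrite -ler_pdivlMr //; apply: le_trans (ltW ba2) _.
    by rewrite le_eqVlt; apply/orP; left; apply/eqP; field; rewrite !gt_eqF //; lra.
  apply: (@le_trans _ _ ((modulus a + 1) * h)); first by apply: ler_wpM2r => //; exact: ltW.
  by rewrite le_eqVlt; apply/orP; left; apply/eqP; rewrite /h; field; rewrite !gt_eqF //; lra.
Qed.

Lemma gauge_open_neighborhood :
  is_neighborhood gauge_open zero (fun x => (rho x <= 1)%E).
Proof.
have [U [Uo U0 UP]] := gauge_open_ball dom0 ltr01.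
exists U; split=> //; first by rewrite -q0.
by move=> _ /UP[u gu ->]; rewrite add0r; exact: rho_le.
Qed.

(** In any linear topology translations and dilations carry the neighbourhood
    [rho <= 1] of [0] to a neighbourhood of any point inside any ball. *)
Lemma gauge_open_least O : linear_topology add scale O ->
  is_neighborhood O zero (fun x => (rho x <= 1)%E) ->
  forall U, gauge_open U -> O U.
Proof.
move=> [[_ _ Ounion] Oadd Oscale] [V0 [OV0 V00 V0P]] U Uo.
suff loc x : U x -> exists W : E -> Prop, [/\ O W, W x & forall y, W y -> U y].
  have -> : U = (fun x => exists2 W : E -> Prop, (O W /\ forall y, W y -> U y) & W x).
    apply/funext => x; apply/propext; split=> [/loc[W [OW Wx WU]]|[W [_ WU]]]; last exact: WU.
    by exists W.
  by apply: Ounion => W [].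
have [v dv ->] := q_onto x => Uv; have [e e0 eU] := Uo v dv Uv.
pose t : R := 2 / e; have t0 : 0 < t by exact: divr_gt0.
have scale0 : scale (of_real t) zero = zero by rewrite -q0 -qZ // scaler0.
have [|B [V3 [tB OV3 V30 V3P]]] := Oscale (of_real t) zero V0 OV0; first by rewrite scale0.
have dNv : gauge_dom g (- v) by rewrite -scaleN1r; exact: domZ.
have [|V1 [V2 [OV1 V1v OV2 V2v V12]]] := Oadd (q v) (q (- v)) V3 OV3.
  by rewrite -qD // subrr q0.
exists V1; split=> // y; have [w dw ->] := q_onto y => V1w.
have := V12 _ _ V1w V2v; rewrite -qD // => /(V3P _ _ (nbhs_singleton tB)).
have dwv := domB dw dv; rewrite -qZ // => /V0P rho1.
have : g (of_real t *: (w - v)) 2.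
  apply: rho_lt; first exact: domZ.
  by apply: le_lt_trans rho1 _; rewrite lte_fin ltr1n.
move=> /(gaugeZ gg (of_real t^-1)).
rewrite modulus_of_real; last by rewrite invr_ge0 ltW.
rewrite scalerA -of_realM mulVf ?gt_eqF // of_real1 scale1r => gwv.
have -> : w = v + (w - v) by rewrite addrC subrK.
apply: eU; move: gwv; congr (g _ _).
by rewrite /t; field; rewrite gt_eqF.
Qed.

Lemma hausdorff_induced_topologyP :
  hausdorff (induced_topology zero add scale rho) <->
  forall v, gauge_null g v -> q v = zero.
Proof.
have D1' := D1; split=> [H v v0|H x y xy].
  apply: contrapT => qv; have [U [W [Uo Uv Wo W0 UW]]] := H _ _ qv.
  have {}Wo := Wo _ gauge_open_linear gauge_open_neighborhood.
  rewrite -q0 in W0; have [e e0 eW] := Wo _ dom0 W0.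
  by apply: (UW (q v)); split=> //; rewrite -[v]add0r; apply: eW; exact: v0.
have [a da xa] := q_onto x; have [b db yb] := q_onto y; have dab := domB da db.
have [e e0 ne] : exists2 e : R, 0 < e & ~ g (a - b) e.
  apply: contrapT => ne; apply: xy; rewrite xa yb -[a](subrK b) qD // H.
    by rewrite -q0 -qD // add0r.
  by move=> e e0; apply: contrapT => nge; apply: ne; exists e.
have h0 : 0 < e / (4 * D) by apply: divr_gt0 => //; lra.
have [U [Uo Ua UP]] := gauge_open_ball da h0.
have [W [Wo Wb WP]] := gauge_open_ball db h0.
exists U, W; rewrite xa yb; split=> // [O Ol On|O Ol On|z [/UP[u gu ->] /WP[u' gu' zz]]].
- exact: gauge_open_least Ol On _ Uo.
- exact: gauge_open_least Ol On _ Wo.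
have du := dom_of gu; have du' := dom_of gu'.
apply: ne; apply: rho_lt => //.
have -> : q (a - b) = q (u' - u).
  have := q_congr (domD da du) (domD db du') (domB (domB dom0 db) du) zz.
  by rewrite !sub0r !(addrACA _ _ (- b)) !subrr addr0 add0r.
apply: le_lt_trans (rho_le (gaugeB gg gu' gu)) _; rewrite lte_fin.
have -> : D * (e / (4 * D) + e / (4 * D)) = e / 2 by field; rewrite gt_eqF //; lra.
by rewrite ltr_pdivrMr //; lra.
Qed.

End InducedTopology.

(** * Sections of extensions *)

Section ExtensionMaps.
Context (R : realType) (s : scalars).
Local Notation K := (Defs.scalar R s).

Lemma qnorm_open_mapping (V W : quasiBanachType R s) (T : {linear V -> W}) :
  continuous T ->
  (forall w, (forall e : R, 0 < e -> exists v, qnorm (w - T v) <= e) -> exists v, T v = w) ->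
  exists2 C : R, 0 <= C & forall v, exists2 v', T v' = T v & qnorm v' <= C * qnorm (T v).
Proof.
move=> /linear_continuous_qnorm[c c0 cP] Tclosed.
pose D := Num.max (qtri V) (qtri W).
have VD : qtri V <= D by rewrite le_max lexx.
have WD : qtri W <= D by rewrite le_max lexx orbT.
have D1 : 1 <= D := le_trans (qtri_ge1 V) VD.
have dom v : gauge_dom (@qgauge R s V) v by exists (qnorm v); exact: lexx.
have bounded : exists2 c : R, 0 <= c &
    forall v r, @qgauge R s V v r -> @qgauge R s W (T v) (c * r).
  by exists c => // v r vr; apply: le_trans (cP v) _; exact: ler_wpM2l.
have closed : closed_range (@qgauge R s V) (@qgauge R s W) T.
  move=> w wP; have [e /wP[v _ vw]|v <-] := Tclosed w; first by exists v.
  by exists v => // e e0; rewrite /qgauge subrr qnorm0 ltW.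
have [C C0 CP] := closed_range_open D1 (qgauge_gauge VD) (qgauge_gauge WD)
  (qgauge_complete VD) bounded (qgauge_complete WD) closed.
exists C => // v; have [v' v'C /qgauge_null Tv'] := CP v _ (dom v) (lexx _).
by exists v' => //; apply/esym/eqP; rewrite -subr_eq0 Tv'.
Qed.

(** Preimages are chosen at one vector of each line and extended by homogeneity. *)
Lemma homogeneous_selection (V W : quasiNormedType R s) (T : {linear V -> W}) (C : R) :
  (forall w, exists2 v, T v = w & qnorm v <= C * qnorm w) ->
  exists B : W -> V, [/\ homogeneous B, forall w, T (B w) = w
    & forall w, qnorm (B w) <= C * qnorm w].
Proof.
move=> TC; have /choice[S SP] w : exists v, T v = w /\ qnorm v <= C * qnorm w.
  by have [v Tv vC] := TC w; exists v.
pose line (w : W) : set W := [set u | exists2 a : K, a != 0 & u = a *: w].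
pose rep w := xget 0 (line w).
have line_id w : line w w by exists 1; rewrite ?oner_neq0 ?scale1r.
have lineZ a w : a != 0 -> line (a *: w) = line w.
  move=> a0; apply/seteqP; split=> u [b b0 ->].
    by exists (b * a); rewrite ?mulf_neq0 ?scalerA.
  exists (b / a); first by rewrite mulf_neq0 ?invr_neq0.
  by rewrite scalerA divfK.
have repP w : exists a : K, a != 0 /\ w = a *: rep w.
  have [a a0 aE] : line w (rep w) by rewrite /rep; apply: xgetPex; exists w.
  by exists a^-1; rewrite invr_neq0 // aE scalerA mulVf // scale1r.
have /choice[c cP] := repP.
have S0 : S (rep 0) = 0.
  have rep0 : rep 0 = 0.
    apply/eqP; have [c0 /esym/eqP] := cP 0.
    by rewrite scaler_eq0 (negbTE c0).
  have := (SP (rep 0)).2; rewrite rep0 qnorm0 mulr0 => S0.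
  by apply: qnorm_eq0; apply/eqP; rewrite eq_le S0 qnorm_ge0.
exists (fun w => c w *: S (rep w)); split.
- move=> a w; have [->|a0] := eqVneq a 0; first by rewrite !scale0r S0 scaler0.
  have repa : rep (a *: w) = rep w by rewrite /rep lineZ.
  have [->|w0] := eqVneq w 0; first by rewrite scaler0 S0 !scaler0.
  rewrite repa scalerA; congr (_ *: _); apply/eqP; rewrite -subr_eq0.
  have r0 : rep w != 0 by apply: contraNneq w0 => r0; rewrite (cP w).2 r0 scaler0.
  have : (c (a *: w) - a * c w) *: rep w == 0.
    by rewrite scalerBl -{1}repa -(cP _).2 -scalerA -(cP _).2 subrr.
  by rewrite scaler_eq0 (negbTE r0) orbF.
- by move=> w; rewrite linearZ /= (SP _).1 -(cP _).2.
- move=> w; rewrite qnormZ [in leRHS](cP w).2 qnormZ mulrCA.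
  by apply: ler_wpM2l; [exact: modulus_ge0|exact: (SP _).2].
Qed.

Context (X Y : quasiBanachType R s) (e : extension X Y).
Let Z := ext_mid e.

Lemma ext_proj_inj y : ext_proj e (ext_inj e y) = 0.
Proof.
have : range (ext_inj e) (ext_inj e y) by exists y.
by rewrite ext_exact.
Qed.

Lemma ext_kernel z : ext_proj e z = 0 -> exists y, ext_inj e y = z.
Proof.
move=> z0; have : (ext_proj e @^-1` [set 0]) z by [].
by rewrite -ext_exact => -[y _ <-]; exists y.
Qed.

Lemma ext_proj_onto x : exists z, ext_proj e z = x.
Proof.
have : range (ext_proj e) x by rewrite ext_proj_surjective.
by case=> z _ <-; exists z.
Qed.

(** The range of the injection is a kernel, hence closed. *)
Lemma ext_inj_bounded_below :
  exists2 C : R, 0 <= C & forall y, qnorm y <= C * qnorm (ext_inj e y).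
Proof.
have [c c0 cP] := linear_continuous_qnorm (@ext_proj_continuous _ _ _ _ e).
have [|w wP|C C0 CP] := @qnorm_open_mapping _ _ (ext_inj e).
- exact: ext_inj_continuous.
- apply: ext_kernel; apply: qgauge_null => d d0.
  have d1 : 0 < d / (c + 1) by apply: divr_gt0 => //; lra.
  have [y yP] := wP _ d1.
  rewrite /qgauge (_ : ext_proj e w = ext_proj e (w - ext_inj e y)); last first.
    by rewrite linearB /= ext_proj_inj subr0.
  apply: le_trans (cP _) _; apply: (@le_trans _ _ ((c + 1) * (d / (c + 1)))).
    by apply: ler_pM => //; [exact: qnorm_ge0|lra].
  by rewrite mulrC divfK // gt_eqF //; lra.
- exists C => // y; have [y' /(@ext_inj_injective _ _ _ _ e) -> //] := CP y.
Qed.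

Lemma ext_bounded_section : exists B : X -> Z, exists C : R,
  [/\ homogeneous B, forall x, ext_proj e (B x) = x & forall x, qnorm (B x) <= C * qnorm x].
Proof.
have [|w _|C C0 CP] := @qnorm_open_mapping _ _ (ext_proj e).
- exact: ext_proj_continuous.
- exact: ext_proj_onto.
have [|B [Bh BP BC]] := @homogeneous_selection _ _ (ext_proj e) C; last by exists B, C.
move=> x; have [z zx] := ext_proj_onto x; have [z' z'z] := CP z.
by rewrite zx in z'z *; exists z'.
Qed.

Lemma ext_linear_section :
  exists L : {linear X -> Z}, forall x, ext_proj e (L x) = x.
Proof. by have [L LP] := linear_section ext_proj_onto; exists L. Qed.

End ExtensionMaps.

(** * Twisted sums *)

Section TwistedSum.
Context (R : realType) (s : scalars) (X Y : quasiBanachType R s).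
Local Notation K := (Defs.scalar R s).

(** A new name for the product, so that it does not carry the product
    quasi-norm. *)
Definition twisted (F : X -> Y) (hF : quasilinear F) : Type := (Y * X)%type.

Section Construction.
Context (F : X -> Y) (hF : quasilinear F).
Local Notation T := (twisted hF).

HB.instance Definition _ := GRing.Lmodule.copy T (Y * X)%type.

Definition twisted_norm (p : T) : R := qnorm (p.1 - F p.2) + qnorm p.2.

Let D : R := mtri X Y.
Let gX : gauge D (@qgauge R s X) := qgauge_gauge (mtriX X Y).
Let gY : gauge D (@qgauge R s Y) := qgauge_gauge (mtriY X Y).

Let Fh : homogeneous F. Proof. by case: hF. Qed.

Let Fdefect : exists2 q : R, 0 <= q &
  forall x y, qgauge (defect F x y) (q * (qnorm x + qnorm y)).
Proof. by case: hF => _ [q [q0 qP]]; exists q. Qed.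

Let twisted_norm_ge0 p : 0 <= twisted_norm p.
Proof. by rewrite addr_ge0 // qnorm_ge0. Qed.

Let twisted_norm_eq0 p : twisted_norm p = 0 -> p = 0.
Proof.
case: p => y x /eqP; rewrite paddr_eq0 ?qnorm_ge0 //= => /andP[/eqP yF /eqP /qnorm_eq0 x0].
by move: yF; rewrite x0 (homogeneous0 Fh) subr0 => /qnorm_eq0 ->.
Qed.

Let twisted_normZ a p : twisted_norm (a *: p) = modulus a * twisted_norm p.
Proof. by rewrite /twisted_norm /= Fh -scalerBr !qnormZ mulrDr. Qed.

Let twisted_normD_ex : exists d : R,
  forall p p', twisted_norm (p + p') <= d * (twisted_norm p + twisted_norm p').
Proof.
have D1 : 1 <= D := mtri_ge1 X Y; have [q q0 qP] := Fdefect.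
exists (D * (D + q) + D) => -[y x] [y' x']; rewrite /twisted_norm /=.
set a := qnorm (y - F x); set a' := qnorm (y' - F x').
have := gaugeB gY (gaugeD gY (lexx a : qgauge _ _) (lexx a' : qgauge _ _)) (qP x x').
have -> : y - F x + (y' - F x') - defect F x x' = y + y' - F (x + x').
  rewrite /defect addrACA -opprD -[LHS]addrA -opprD; congr (_ - _).
  by rewrite -[_ - F x - F x']addrA -opprD [LHS]addrC subrK.
have := gaugeD gX (lexx (qnorm x) : qgauge _ _) (lexx (qnorm x') : qgauge _ _).
rewrite /qgauge; set b := qnorm x; set b' := qnorm x' => h1 h2.
have a0 : 0 <= a := qnorm_ge0 _; have a'0 : 0 <= a' := qnorm_ge0 _.
have b0 : 0 <= b := qnorm_ge0 _; have b'0 : 0 <= b' := qnorm_ge0 _.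
apply: le_trans (lerD h2 h1) _.
have t1 : 0 <= D * q * (a + a') by rewrite !mulr_ge0 ?addr_ge0 //; lra.
have t2 : 0 <= D * D * (b + b') by rewrite !mulr_ge0 ?addr_ge0 //; lra.
have t3 : 0 <= D * (a + a') by rewrite !mulr_ge0 ?addr_ge0 //; lra.
lra.
Qed.

Definition twisted_entourage : set_system (T * T) :=
  [set A : set (T * T) | exists2 e : R, 0 < e &
     [set pp' : T * T | twisted_norm (pp'.1 - pp'.2) < e] `<=` A].

Let twisted_norm0 : twisted_norm 0 = 0.
Proof. by rewrite -(scale0r 0) twisted_normZ modulus0 mul0r. Qed.

Let twisted_normN p : twisted_norm (- p) = twisted_norm p.
Proof. by rewrite -scaleN1r twisted_normZ modulusN modulus1 mul1r. Qed.

Let twisted_entourage_filter : Filter twisted_entourage.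
Proof.
split=> [|A B [e e0 eA] [e' e'0 eB]|A B AB [e e0 eA]].
- by exists 1.
- exists (Num.min e e'); first by rewrite lt_min e0.
  move=> p; rewrite /= lt_min => /andP[pe pe'].
  by split; [exact: eA|exact: eB].
- by exists e => //; exact: subset_trans AB.
Qed.

Let twisted_entourage_refl A : twisted_entourage A -> diagonal `<=` A.
Proof.
move=> [e e0 eA] [p p'] pp'; apply: eA.
by rewrite /= (pp' : p = p') subrr twisted_norm0.
Qed.

Let twisted_entourage_inv A : twisted_entourage A -> twisted_entourage A^-1%relation.
Proof.
move=> [e e0 eA]; exists e => // -[p p'] /= pe; apply: eA => /=.
by rewrite -twisted_normN opprB.
Qed.

Let twisted_entourage_split A : twisted_entourage A ->
  exists2 B, twisted_entourage B & (B \; B `<=` A)%relation.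
Proof.
move=> [e e0 eA]; have [d dP] := twisted_normD_ex.
have d0 : 0 < 2 * (`|d| + 1) by rewrite mulr_gt0 // ltr_wpDl.
exists [set pp' : T * T | twisted_norm (pp'.1 - pp'.2) < e / (2 * (`|d| + 1))].
  by exists (e / (2 * (`|d| + 1))); first exact: divr_gt0.
move=> [p p'] [p2 /= pp2 p2p']; apply: eA => /=.
rewrite -(subrK p2 p) -addrA; apply: le_lt_trans (dP _ _) _.
have s0 := addr_ge0 (twisted_norm_ge0 (p - p2)) (twisted_norm_ge0 (p2 - p')).
apply: (@le_lt_trans _ _ ((`|d| + 1) * (twisted_norm (p - p2) + twisted_norm (p2 - p')))).
  by apply: ler_wpM2r => //; have := ler_norm d; lra.
rewrite -ltr_pdivlMl; last by rewrite ltr_wpDl.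
apply: lt_le_trans (ltrD pp2 p2p') _.
rewrite le_eqVlt; apply/orP; left; apply/eqP; field.
by rewrite gt_eqF // ltr_wpDl.
Qed.

HB.instance Definition _ := isUniform.Build T twisted_entourage_filter
  twisted_entourage_refl twisted_entourage_inv twisted_entourage_split.

HB.instance Definition _ := isQuasiNormed.Build R s T
  twisted_norm_ge0 twisted_norm_eq0 twisted_normZ twisted_normD_ex erefl.

(** A Cauchy filter converges first in [X], say to [x]; then the first components
    have to be compared with [F (x' - x)], which makes them Cauchy in [Y]. *)
Let twisted_complete (Fl : set_system T) :
  ProperFilter Fl -> cauchy Fl -> exists p : T, Fl --> p.
Proof.
move=> FF cF; have D1 : 1 <= D := mtri_ge1 X Y; have [q q0 qP] := Fdefect.
have cauchyP e : 0 < e -> exists P Q, [/\ Fl P, Fl Q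
    & forall p p', P p -> Q p' -> twisted_norm (p - p') < e].
  move=> e0; 
  have [|[P Q] /= [FP FQ] PQ] :=
      cF [set pp' : T * T | twisted_norm (pp'.1 - pp'.2) < e].
    by exists e.
  by exists P, Q; split=> // p p' Pp Qp'; exact: (PQ (p, p')).
have image_in (S : Type) (f : T -> S) P : Fl P -> Fl (f @^-1` (f @` P)).
  by move=> FP; apply: filterS FP => p Pp; exists p.
have cauchyX : cauchy (@snd Y X @ Fl).
  move=> A; rewrite qnorm_entourageE => -[e e0 eA].
  have [P [Q [FP FQ PQ]]] := cauchyP e e0.
  exists (@snd Y X @` P, @snd Y X @` Q); first by split; exact: image_in.
  case=> _ _ /= [[p Pp <-] [p' Qp' <-]]; apply: eA => /=.
  by apply: le_lt_trans (PQ p p' Pp Qp'); rewrite lerDr qnorm_ge0.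
have [x Fx] := qcomplete _ _ cauchyX.
have nearx e : 0 < e -> Fl [set p : T | qnorm (p.2 - x) < e].
  by move=> e0; apply: (Fx [set x' | qnorm (x' - x) < e]); apply/nbhs_qnormP; exists e.
pose h (p : T) : Y := p.1 - F (p.2 - x).
have cauchyY : cauchy (h @ Fl).
  move=> A; rewrite qnorm_entourageE => -[e e0 eA].
  have c0 : 0 < D * (2 + q * 2) by rewrite mulr_gt0 //; lra.
  pose d := e / (D * (2 + q * 2)); have d0 : 0 < d by exact: divr_gt0.
  have [P [Q [FP FQ PQ]]] := cauchyP d d0.
  have Fd := nearx d d0.
  exists (h @` (P `&` [set p : T | qnorm (p.2 - x) < d]),
          h @` (Q `&` [set p : T | qnorm (p.2 - x) < d])).
    by split; apply: image_in; exact: filterI.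
  case=> _ _ /= [[p [Pp px] <-] [p' [Qp' p'x] <-]]; apply: eA => /=.
  have hE : h p - h p' = (p.1 - p'.1 - F (p.2 - p'.2)) + defect F (p.2 - x) (x - p'.2).
    have xE : p.2 - x + (x - p'.2) = p.2 - p'.2 by rewrite addrA subrK.
    have FN : F (x - p'.2) = - F (p'.2 - x) by rewrite -opprB -scaleN1r Fh scaleN1r.
    rewrite /defect xE FN opprK [RHS]addrA [_ + (F _ - F _)]addrA subrK.
    by rewrite /h opprD opprK addrA; congr (_ + _); rewrite addrAC.
  have h1 : qnorm (p.1 - p'.1 - F (p.2 - p'.2)) < d.
    by apply: le_lt_trans (PQ p p' Pp Qp'); rewrite lerDl qnorm_ge0.
  have := gaugeD gY (ltW h1 : qgauge _ _) (qP (p.2 - x) (x - p'.2)).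
  rewrite -hE (qnorm_distC x) => /le_lt_trans; apply.
  have -> : e = D * (d + d + q * (d + d)) by rewrite /d; field; rewrite !gt_eqF //; lra.
  have : q * (qnorm (p.2 - x) + qnorm (p'.2 - x)) <= q * (d + d).
    by apply: ler_wpM2l => //; apply: lerD; exact: ltW.
  by move=> qd; rewrite ltr_pM2l; lra.
have [y Fy] := qcomplete _ _ cauchyY.
exists (y, x) => A /nbhs_qnormP[e e0 eA].
have e2 : 0 < e / 2 by exact: divr_gt0.
have Fye : Fl [set p : T | qnorm (h p - y) < e / 2].
  by apply: (Fy [set y' | qnorm (y' - y) < e / 2]); apply/nbhs_qnormP; exists (e / 2).
apply: filterS (filterI Fye (nearx _ e2)) => p /= [py px]; apply: eA.
rewrite (splitr e); apply: ltrD => //=; move: py; congr (qnorm _ < _).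
by rewrite /h addrAC.
Qed.

HB.instance Definition _ :=
  QuasiNormed_isComplete.Build R s T twisted_complete.

End Construction.
End TwistedSum.

(** * Extensions and the quasilinear maps representing them *)

Section TwistedExtension.
Context (R : realType) (s : scalars) (X Y : quasiBanachType R s).
Local Notation K := (Defs.scalar R s).

Section Maps.
Context (F : X -> Y) (hF : quasilinear F).

Definition twisted_inj (y : Y) : twisted hF := (y, 0).
Definition twisted_proj (p : twisted hF) : X := p.2.

Let twisted_inj_linear : linear twisted_inj.
Proof. by move=> a y y'; rewrite /twisted_inj; congr pair; rewrite /= scaler0 addr0. Qed.
HB.instance Definition _ := GRing.isLinear.Build K Y (twisted hF) _ twisted_inj
  twisted_inj_linear.

Let twisted_proj_linear : linear twisted_proj.
Proof. by []. Qed.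
HB.instance Definition _ := GRing.isLinear.Build K (twisted hF) X _ twisted_proj
  twisted_proj_linear.

Let twisted_inj_continuous : continuous twisted_inj.
Proof.
apply: (@linear_qnorm_continuous R s Y (twisted hF) twisted_inj); exists 1 => // y.
by rewrite /qnorm /= /twisted_norm /= (homogeneous0 hF.1) subr0 qnorm0 addr0 mul1r.
Qed.

Let twisted_proj_continuous : continuous twisted_proj.
Proof.
apply: (@linear_qnorm_continuous R s (twisted hF) X twisted_proj); exists 1 => // p.
by rewrite mul1r lerDr qnorm_ge0.
Qed.

Let twisted_inj_injective : injective twisted_inj.
Proof. by move=> y y' []. Qed.

Let twisted_proj_surjective : range twisted_proj = setT.
Proof. by apply/seteqP; split=> // x _; exists (0, x). Qed.

Let twisted_exact : range twisted_inj = twisted_proj @^-1` [set 0].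
Proof.
apply/seteqP; split=> [_ [y _ <-] //|[y x] /= x0].
by exists y => //; rewrite /twisted_inj -x0.
Qed.

Definition twisted_extension : extension X Y :=
  @Extension R s X Y (twisted hF) twisted_inj twisted_proj twisted_inj_continuous
    twisted_proj_continuous twisted_inj_injective twisted_proj_surjective twisted_exact.

End Maps.

Lemma twisted_qnormE (F : X -> Y) (hF : quasilinear F) (y : Y) (x : X) :
  qnorm ((y, x) : twisted hF) = qnorm (y - F x) + qnorm x.
Proof. by []. Qed.

(** Equivalence of [e] with the twisted sum of [F], expressed in [e] alone: in
    the twisted sum [x] goes to [(0, x)] linearly and to [(F x, x)] boundedly. *)
Definition represents (e : extension X Y) (F : X -> Y) : Prop :=
  exists l : {linear X -> ext_mid e}, (forall x, ext_proj e (l x) = x) /\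
    exists2 C : R, 0 <= C & forall x, qnorm (ext_inj e (F x) + l x) <= C * qnorm x.

Lemma represents_equiv e F (hF : quasilinear F) : represents e F ->
  ext_equiv (twisted_extension hF) e /\ ext_equiv e (twisted_extension hF).
Proof.
move=> [l [lP [C C0 CP]]].
have [c c0 cP] := linear_continuous_qnorm (@ext_inj_continuous _ _ _ _ e).
have [b b0 bP] := ext_inj_bounded_below e.
have [p p0 pP] := linear_continuous_qnorm (@ext_proj_continuous _ _ _ _ e).
have D1 := qtri_ge1 (ext_mid e); set D := qtri _ in D1.
split.
- have [|t tE] := @linear_map_of _ (twisted hF) (ext_mid e)
    (fun q => ext_inj e q.1 + l q.2).
    by move=> a [y x] [y' x'] /=; rewrite !linearP scalerDr addrACA.
  exists t; split; last 1 first.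
  + by move=> [y x]; rewrite /= tE /= linearD /= ext_proj_inj lP add0r.
  + apply: linear_qnorm_continuous; exists (D * (c + C)).
      by apply: mulr_ge0; [lra|exact: addr_ge0].
    move=> [y x]; rewrite tE /= twisted_qnormE -mulrA.
    have -> : ext_inj e y + l x = ext_inj e (y - F x) + (ext_inj e (F x) + l x).
      by rewrite linearB /= addrA subrK.
    apply: le_trans (qnormD _ _) _; apply: ler_wpM2l; first by rewrite -/D; lra.
    apply: le_trans (lerD (cP _) (CP _)) _.
    have := qnorm_ge0 (y - F x); have := qnorm_ge0 x => x0 y0.
    by have := mulr_ge0 c0 x0; have := mulr_ge0 C0 y0; lra.
  + by move=> y /=; rewrite tE /= linear0 addr0.
- have /choice[k kP] z : exists y, ext_inj e y = z - l (ext_proj e z).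
    by apply: ext_kernel; rewrite linearB /= lP subrr.
  have [|t tE] := @linear_map_of _ (ext_mid e) (twisted hF) (fun z => (k z, ext_proj e z)).
    move=> a z z'; congr pair; last by rewrite linearP.
    apply: (@ext_inj_injective _ _ _ _ e); rewrite linearP /= !kP !linearP /=.
    by rewrite scalerBr -scalerN addrACA.
  exists t; split; last 1 first.
  + by move=> z; rewrite /= tE.
  + apply: linear_qnorm_continuous; exists (b * (D * (1 + C * p)) + p).
      apply: addr_ge0 => //; apply: mulr_ge0 => //; apply: mulr_ge0; first lra.
      by apply: addr_ge0 => //; exact: mulr_ge0.
    move=> z; rewrite tE twisted_qnormE mulrDl; apply: lerD (pP z).
    apply: le_trans (bP _) _; rewrite -mulrA; apply: ler_wpM2l => //.
    have -> : ext_inj e (k z - F (ext_proj e z)) =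
        z - (ext_inj e (F (ext_proj e z)) + l (ext_proj e z)).
      by rewrite linearB /= kP opprD addrA addrAC.
    apply: le_trans (qnormD _ _) _; rewrite qnormN -mulrA.
    apply: ler_wpM2l; first by rewrite -/D; lra.
    rewrite mulrDl mul1r; apply: lerD => //; apply: le_trans (CP _) _.
    by rewrite -mulrA; apply: ler_wpM2l => //.
  + move=> y /=; rewrite tE ext_proj_inj; congr pair.
    by apply: (@ext_inj_injective _ _ _ _ e); rewrite kP ext_proj_inj linear0 subr0.
Qed.

Lemma equiv_represents e F (hF : quasilinear F) :
  ext_equiv (twisted_extension hF) e -> represents e F.
Proof.
move=> [t [/linear_continuous_qnorm[C C0 CP] tinj tproj]].
have [|l lE] := @linear_map_of _ X (ext_mid e) (fun x => t ((0, x) : twisted hF)).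
  move=> a x x'; rewrite -linearP; congr (t _); congr pair.
  by rewrite /= scaler0 addr0.
exists l; split=> [x|]; first by rewrite lE; exact: tproj.
exists C => // x; rewrite lE -tinj /= -linearD.
apply: le_trans (CP _) _; apply: ler_wpM2l => //.
rewrite /= twisted_qnormE /= addr0 add0r subrr qnorm0 add0r.
exact: lexx.
Qed.

(** A bounded section and a linear section of the same extension differ by a map
    into [Y], which has the defect of the bounded one. *)
Lemma section_represents e (B : X -> ext_mid e) (C r : R) :
  homogeneous B -> (forall x, ext_proj e (B x) = x) ->
  (forall x, qnorm (B x) <= C * qnorm x) -> 0 <= r ->
  (forall x y w, ext_inj e w = B (x + y) - B x - B y ->
     qnorm w <= r * (qnorm x + qnorm y)) ->
  exists2 F, dgauge F r & represents e F.
Proof.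
move=> Bh BP BC r0 Br; pose Z := ext_mid e; have [L LP] := ext_linear_section e.
have /choice[F FP] x : exists y, ext_inj e y = B x - L x.
  by apply: ext_kernel; rewrite linearB /= BP LP subrr.
exists F.
  split=> // [a x|x y].
    by apply: (@ext_inj_injective _ _ _ _ e); rewrite linearZ /= !FP Bh linearZ scalerBr.
  apply: Br; have -> : ext_inj e (defect F x y) = defect (B + (-1) *: (L : X -> Z)) x y.
    have BL z : (B + (-1) *: (L : X -> Z)) z = ext_inj e (F z).
      by rewrite FP addrfctE scalrfctE scaleN1r.
    by rewrite /defect !BL !linearB.
  by rewrite defectD defectZ defect_linear scaler0 addr0.
exists L; split=> //; exists `|C| => // x; rewrite FP subrK; apply: le_trans (BC x) _.
by apply: ler_wpM2r; [exact: qnorm_ge0|exact: ler_norm].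
Qed.

Lemma represents_ex e : exists2 F, quasilinear F & represents e F.
Proof.
have [B [C [Bh BP BC]]] := ext_bounded_section e.
have [b b0 bP] := ext_inj_bounded_below e.
pose D := Num.max (qtri X) (qtri (ext_mid e)).
have gX : gauge D (@qgauge R s X) by apply: qgauge_gauge; rewrite le_max lexx.
have gZ : gauge D (@qgauge R s (ext_mid e)).
  by apply: qgauge_gauge; rewrite le_max lexx orbT.
have D1 : 1 <= D by rewrite le_max qtri_ge1.
have BC' x : qnorm (B x) <= `|C| * qnorm x.
  by apply: le_trans (BC x) _; apply: ler_wpM2r; [exact: qnorm_ge0|exact: ler_norm].
have r0 : 0 <= b * (D * (D * (`|C| * D + `|C|) + `|C|)).
  by do !(apply: mulr_ge0 || apply: addr_ge0 || exact: normr_ge0) => //; lra.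
have [|F Fr Frep] := section_represents Bh BP BC r0; last first.
  by exists F => //; apply/quasilinearP; eexists; exact: Fr.
move=> x y w wE; apply: le_trans (bP w) _; rewrite -mulrA; apply: ler_wpM2l => //.
rewrite wE.
have Bxy : qgauge (B (x + y)) (`|C| * (D * (qnorm x + qnorm y))).
  apply: le_trans (BC' _) _; apply: ler_wpM2l => //.
  exact: (gaugeD gX (lexx _ : qgauge _ _) (lexx _ : qgauge _ _)).
apply: le_trans (gaugeB gZ (gaugeB gZ Bxy (BC' x)) (BC' y)) _.
have x0 := qnorm_ge0 x; have y0 := qnorm_ge0 y; have C0 := normr_ge0 C.
have t1 : 0 <= D * (D * (`|C| * qnorm y)) by do !apply: mulr_ge0 => //; lra.
have t2 : 0 <= D * (`|C| * qnorm x) by do !apply: mulr_ge0 => //; lra.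
lra.
Qed.

(** The linear section of the twisted sum of [G] is [x |-> (- L x, x)]. *)
Lemma represents_twisted F G (hG : quasilinear G) : homogeneous F ->
  represents (twisted_extension hG) F <->
  exists L : {linear X -> Y}, gauge_dom (@bgauge R s X Y) (F - G - (L : X -> Y)).
Proof.
move=> Fh; have normE (y y' : Y) (x : X) : qnorm ((y, 0) + (y', x) : twisted hG) =
    qnorm (y + y' - G x) + qnorm x.
  by rewrite [LHS]/qnorm /= /twisted_norm /= add0r.
split=> [[l [lP [C C0 CP]]]|[L [C [C0 Bh BC]]]].
  have [|L LE] := @linear_map_of _ X Y (fun x => - (l x).1).
    by move=> a x x'; rewrite linearP /= opprD scalerN.
  exists L, C; split=> // [a x|x].
    by rewrite !addrfctE !opprfctE Fh hG.1 [L _]linearZ /= !scalerBr.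
  have lx : l x = ((l x).1, x) :> Y * X by move: (lP x); case: (l x) => y z /= <-.
  apply: le_trans (CP x); rewrite lx normE !addrfctE !opprfctE LE opprK addrAC.
  by rewrite lerDl qnorm_ge0.
have [|l lE] := @linear_map_of _ X (twisted hG) (fun x => (- L x, x)).
  by move=> a x x'; congr pair; rewrite linearP /= opprD scalerN.
exists l; split=> [x|]; first by rewrite lE.
exists (C + 1); first by rewrite addr_ge0.
move=> x; rewrite lE normE mulrDl mul1r lerD2r.
by have := BC x; rewrite !addrfctE !opprfctE addrAC.
Qed.

Lemma ext_equiv_refl e : @ext_equiv R s X Y e e.
Proof.
have [//|t tE] := @linear_map_of _ (ext_mid e) (ext_mid e) id.
exists t; split=> [|y|z] /=; rewrite ?tE //.
by apply: linear_qnorm_continuous; exists 1 => // z; rewrite tE mul1r.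
Qed.

Lemma ext_equiv_trans e1 e2 e3 :
  @ext_equiv R s X Y e1 e2 -> ext_equiv e2 e3 -> ext_equiv e1 e3.
Proof.
move=> [t [tc ti tp]] [t' [t'c t'i t'p]].
have [|u uE] := @linear_map_of _ (ext_mid e1) (ext_mid e3) (t' \o t).
  by move=> a x y /=; rewrite !linearP.
exists u; split=> [|y|z] /=; last 2 first.
- by rewrite uE /= -t'i /= -ti.
- by rewrite uE /= -tp /= -t'p.
- have -> : u = t' \o t :> (_ -> _) by apply/funext => z; rewrite uE.
  by move=> z; apply: continuous_comp; [exact: tc|exact: t'c].
Qed.

(** Both extensions are equivalent, in both directions, to one twisted sum. *)
Lemma ext_equiv_sym e e' : @ext_equiv R s X Y e e' -> ext_equiv e' e.
Proof.
have [F hF Fe] := represents_ex e.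
have [Fe1 Fe2] := represents_equiv hF Fe => ee'.
have Fe' := ext_equiv_trans Fe1 ee'.
have [_ e'F] := represents_equiv hF (equiv_represents Fe').
exact: ext_equiv_trans e'F Fe1.
Qed.

Lemma ext_class_eqP e e' : ext_class e = ext_class e' :> Ext X Y <-> ext_equiv e e'.
Proof.
split=> [/(congr1 (@ext_members _ _ _ _)) /= E|ee'].
  have : Defs.equiv_class e' e' by exact: ext_equiv_refl.
  by rewrite -E.
have E : Defs.equiv_class e = Defs.equiv_class e'.
  apply/funext => e2; apply/propext; split; first exact: ext_equiv_trans (ext_equiv_sym ee').
  exact: ext_equiv_trans ee'.
rewrite /ext_class; move: (ex_intro _ e' _) (ex_intro _ e _); rewrite E => p p'.
by congr MkExt; exact: Prop_irrelevance.
Qed.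

End TwistedExtension.

(** * The space of extensions *)

Section ExtensionSpace.
Context (R : realType) (s : scalars) (X Y : quasiBanachType R s).
Local Notation K := (Defs.scalar R s).
Implicit Types F G : X -> Y.

Let gd := dgauge_gauge X Y.
Let gb := bgauge_gauge X Y.

Definition ext_of F : Ext X Y :=
  if pselect (quasilinear F) is left hF then ext_class (twisted_extension hF)
  else ext0 X Y.

Lemma ext_ofE F (hF : quasilinear F) : ext_of F = ext_class (twisted_extension hF).
Proof.
rewrite /ext_of; case: pselect => // h.
by congr (ext_class (twisted_extension _)); exact: Prop_irrelevance.
Qed.

Lemma ext_of_represents e F : quasilinear F -> represents e F -> ext_of F = ext_class e.
Proof.
move=> hF eF; rewrite (ext_ofE hF); apply/ext_class_eqP.
by have [] := represents_equiv hF eF.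
Qed.

Lemma ext_of_onto c : exists2 F, quasilinear F & c = ext_of F.
Proof.
case: c => m mP; have [e me] := mP; have [F hF eF] := represents_ex e; exists F => //.
rewrite (ext_of_represents hF eF) /ext_class; move: mP (ex_intro _ e _).
by rewrite me => p p'; congr MkExt; exact: Prop_irrelevance.
Qed.

Lemma ext_of_eqP F G : quasilinear F -> quasilinear G ->
  ext_of F = ext_of G <->
  exists L : {linear X -> Y}, gauge_dom (@bgauge R s X Y) (F - G - (L : X -> Y)).
Proof.
move=> hF hG; rewrite -(represents_twisted hG hF.1) (ext_ofE hF) (ext_ofE hG).
split=> [/ext_class_eqP|FG]; first exact: equiv_represents.
by apply/ext_class_eqP; have [] := represents_equiv hF FG.
Qed.

Lemma ext_of_class F e : quasilinear F -> ext_of F = ext_class e -> represents e F.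
Proof. by move=> hF; rewrite (ext_ofE hF) => /ext_class_eqP; exact: equiv_represents. Qed.

Lemma ext_theE (P : Ext X Y -> Prop) c : P c -> (forall c', P c' -> c' = c) -> ext_the P = c.
Proof.
move=> Pc Pu; rewrite /ext_the; case: pselect => [ex|nex]; last by case: nex; exists c.
by case: cid => c' Pc'; exact: Pu.
Qed.

Lemma quasilinearD F G : quasilinear F -> quasilinear G -> quasilinear (F + G).
Proof.
move=> /quasilinearP hF /quasilinearP hG; apply/quasilinearP.
exact: (gauge_domD gd).
Qed.

Lemma quasilinearZ a F : quasilinear F -> quasilinear (a *: F).
Proof. by move=> /quasilinearP hF; apply/quasilinearP; exact: (gauge_domZ gd). Qed.

Lemma quasilinear0 : quasilinear (0 : X -> Y).
Proof. by apply/quasilinearP; exists 0; exact: (gauge0 gd). Qed.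

Lemma ext_of0 : ext_of 0 = ext0 X Y.
Proof.
apply: ext_of_represents; first exact: quasilinear0.
have [|l lE] := @linear_map_of _ X (Y * X)%type (fun x => (0, x)).
  by move=> a x y; congr pair; rewrite /= scaler0 addr0.
exists l; split=> [x|]; first by rewrite lE.
exists 1 => // x; rewrite lE mul1r /=.
by rewrite /qnorm /= /prod_qnorm /= addr0 add0r qnorm0 add0r.
Qed.

Lemma baer_sum_twisted F G (hF : quasilinear F) (hG : quasilinear G)
    (hFG : quasilinear (F + G)) :
  is_baer_sum (twisted_extension hF) (twisted_extension hG) (twisted_extension hFG).
Proof.
pose T (p : twisted hF * twisted hG) : twisted hFG := (p.1.1 + p.2.1, p.1.2).
exists T; split.
- move=> a p q _ _; congr pair; rewrite /=.
  by rewrite scalerDr addrACA.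
- apply: (@linear_on_qnorm_continuous R s (twisted hF * twisted hG)%type (twisted hFG)).
    move=> a [[y1 x1] [y2 x2]] [[y1' x1'] [y2' x2']]; rewrite /twisted_proj /= => -> ->.
    split=> //; congr pair; rewrite /=; by rewrite scalerDr addrACA.
  have D1 := qtri_ge1 Y; exists (qtri Y + 1); first lra.
  move=> [[y1 x] [y2 x']] /= <-; rewrite {}/T /= twisted_qnormE.
  rewrite [in leRHS]/qnorm /= /prod_qnorm /= !twisted_qnormE addrfctE opprD addrACA.
  have y10 := qnorm_ge0 (y1 - F x); have y20 := qnorm_ge0 (y2 - G x).
  have x0 := qnorm_ge0 x; have Dx := mulr_ge0 (qnorm_ge0 x) (le_trans ler01 D1).
  by apply: le_trans (lerD (qnormD _ _) (lexx _)) _; lra.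
- move=> y1 y2; congr pair; exact: addr0.
- by move=> p _.
Qed.

(** The morphism defining the Baer sum adds the linear sections, and it is bounded
    on the pairs of bounded maps of [e1] and [e2]. *)
Lemma represents_baer_sum e1 e2 e3 F G : is_baer_sum e1 e2 e3 ->
  represents e1 F -> represents e2 G -> represents e3 (F + G).
Proof.
move=> [T [TL Tc Tinj Tproj]] [l1 [l1P [C1 C10 C1P]]] [l2 [l2P [C2 C20 C2P]]].
set P := [set p | _] in TL Tc Tproj.
have Pl x : P (l1 x, l2 x) by rewrite /P /= l1P l2P.
have [|l lE] := @linear_map_of _ X (ext_mid e3) (fun x => T (l1 x, l2 x)).
  by move=> a x y; rewrite -TL // !linearP.
exists l; split=> [x|]; first by rewrite lE (Tproj _ (Pl x)) /= l1P.
have [||C C0 CP] := linear_on_continuous_qnorm _ _ Tc.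
- by rewrite /P /= !linear0.
- move=> a [p1 p2] [q1 q2] Pp Pq; split; last exact: TL.
  by rewrite /P /= !linearP (Pp : ext_proj e1 p1 = _) (Pq : ext_proj e1 q1 = _).
exists (C * (C1 + C2)); first by rewrite mulr_ge0 ?addr_ge0.
move=> x; have PFG : P (ext_inj e1 (F x), ext_inj e2 (G x)).
  by rewrite /P /= !ext_proj_inj.
have -> : ext_inj e3 ((F + G) x) + l x =
    T (ext_inj e1 (F x) + l1 x, ext_inj e2 (G x) + l2 x).
  rewrite lE -Tinj -[T (ext_inj e1 _, _)]scale1r -TL //; congr T.
  by rewrite scale1r.
apply: le_trans (CP _ _) _; first by rewrite /P /= !linearD /= !ext_proj_inj l1P l2P.
rewrite -mulrA; apply: ler_wpM2l => //.
by rewrite mulrDl; exact: (lerD (C1P x) (C2P x)).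
Qed.

Lemma ext_ofD F G : quasilinear F -> quasilinear G ->
  ext_of (F + G) = ext_add (ext_of F) (ext_of G).
Proof.
move=> hF hG; have hFG := quasilinearD hF hG; apply/esym/ext_theE.
  exists (twisted_extension hF), (twisted_extension hG), (twisted_extension hFG).
  by rewrite !ext_ofE; split=> //; exact: baer_sum_twisted.
move=> _ [e1 [e2 [e3 [Fe1 Ge2 -> be]]]]; apply/esym/ext_of_represents => //.
by apply: represents_baer_sum be _ _; exact: ext_of_class.
Qed.

Lemma multiple_twisted a F (hF : quasilinear F) (haF : quasilinear (a *: F)) :
  is_multiple a (twisted_extension hF) (twisted_extension haF).
Proof.
have [|T TE] := @linear_map_of _ (twisted hF) (twisted haF) (fun p => (a *: p.1, p.2)).
  move=> b p q; congr pair; rewrite /=.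
  by rewrite scalerDr !scalerA mulrC.
exists T; split.
- apply: linear_qnorm_continuous; exists (modulus a + 1).
    by rewrite addr_ge0 // modulus_ge0.
  move=> [y x]; rewrite TE !twisted_qnormE /= scalrfctE -scalerBr qnormZ.
  rewrite mulrDl mul1r mulrDr lerD //; last by rewrite lerDr qnorm_ge0.
  by rewrite lerDl mulr_ge0 ?modulus_ge0 ?qnorm_ge0.
- by move=> y; rewrite TE.
- by move=> p; rewrite /= TE.
Qed.

Lemma represents_multiple a e e' F : is_multiple a e e' ->
  represents e F -> represents e' (a *: F).
Proof.
move=> [T [/linear_continuous_qnorm[c c0 cP] Tinj Tproj]] [l [lP [C C0 CP]]].
have [|l' lE] := @linear_map_of _ X (ext_mid e') (T \o l).
  by move=> b x y /=; rewrite !linearP.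
exists l'; split=> [x|]; first by rewrite lE; have := Tproj (l x); rewrite /= lP.
exists (c * C); first exact: mulr_ge0.
move=> x; rewrite lE /= -Tinj -linearD; apply: le_trans (cP _) _.
by rewrite -mulrA; exact: ler_wpM2l.
Qed.

Lemma ext_ofZ a F : quasilinear F -> ext_of (a *: F) = ext_scale a (ext_of F).
Proof.
move=> hF; have haF := quasilinearZ a hF; apply/esym/ext_theE.
  exists (twisted_extension hF), (twisted_extension haF).
  by rewrite !ext_ofE; split=> //; exact: multiple_twisted.
move=> _ [e [e' [Fe -> ae]]]; apply/esym/ext_of_represents => //.
by apply: represents_multiple ae _; exact: ext_of_class.
Qed.

(** The size of the class of [F]: bounded perturbations of [F] are allowed, and
    linear ones do not change the defect. *)
Definition ext_gauge F (r : R) : Prop :=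
  exists2 B, gauge_dom (@bgauge R s X Y) B & dgauge (F - B) r.

Lemma ext_gauge_gauge : gauge (mtri X Y) ext_gauge.
Proof.
split.
- by move=> F r [B _ /(gauge_ge0 gd)].
- by move=> F r t [B Bb FB] rt; exists B => //; exact: (gauge_le gd FB).
- exists 0; first by exists 0; exact: (gauge0 gb).
  by rewrite subr0; exact: (gauge0 gd).
- move=> F G r t [B Bb FB] [C Cb GC]; exists (B + C); first exact: (gauge_domD gb).
  by rewrite opprD addrACA; exact: (gaugeD gd).
- move=> a F r [B Bb FB]; exists (a *: B); first exact: (gauge_domZ gb).
  by rewrite -scalerBr; exact: (gaugeZ gd).
Qed.

Lemma ext_gauge_domP F : gauge_dom ext_gauge F <-> quasilinear F.
Proof.
split=> [[r [B [t Bt] FB]]|/quasilinearP[r Fr]].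
  apply/quasilinearP; rewrite -(subrK B F); apply: (gauge_domD gd); first by exists r.
  by eexists; exact: bgauge_dgauge Bt.
exists r, 0; first by exists 0; exact: (gauge0 gb).
by rewrite subr0.
Qed.

(** The twisted sum of [F - B] is an extension in the class of [F]; its bounded
    section [x |-> (F x - B x, x)] has the defect of [F - B]. *)
Lemma ext_gauge_rho F r : ext_gauge F r -> (rho (ext_of F) <= r%:E)%E.
Proof.
move=> Fr; have hF : quasilinear F by apply/ext_gauge_domP; exists r.
have [B Bb FB] := Fr; have hG : quasilinear (F - B) by apply/quasilinearP; exists r.
set G := F - B in FB hG.
apply: (@le_trans _ _ (rho_extension (twisted_extension hG))).
  apply: ereal_inf_lbound; exists (twisted_extension hG) => //.
  have : ext_of F = ext_of G.
    apply/ext_of_eqP => //.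
    have [|L LE] := @linear_map_of _ X Y (fun=> 0).
      by move=> a x y; rewrite scaler0 addr0.
    exists L; rewrite subKr (_ : _ - _ = B) //.
    by apply/funext => x; rewrite addrfctE opprfctE LE subr0.
  by rewrite (ext_ofE hF) (ext_ofE hG) => /ext_class_eqP.
pose S (x : X) : ext_mid (twisted_extension hG) := ((G x, x) : twisted hG).
apply: (@le_trans _ _ (rho_section S)).
  apply: ereal_inf_lbound; exists S => //; split=> //.
  have Sh : homogeneous S.
    move=> a x; apply: (congr1 (fun y : Y => (y, a *: x))); exact: hG.1.
  split=> //; apply: le_lt_trans (ltry 1).
  apply: ge_ereal_sup => _ [x /= x1 <-]; rewrite lee_fin.
  by rewrite twisted_qnormE subrr qnorm0 add0r.
apply: ge_ereal_sup => _ [x [y [w [wS ->]]]]; rewrite lee_fin.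
have -> : w = defect G x y by move: wS => /(congr1 (@fst Y X)).
have [r0 _ /(_ x y)] := FB.
have := addr_ge0 (qnorm_ge0 x) (qnorm_ge0 y).
rewrite le_eqVlt => /orP[/eqP <- _|n0]; first by rewrite invr0 mulr0.
by rewrite ler_pdivrMr.
Qed.

(** A bounded section in an extension of the class of [F] yields a quasilinear map
    with the same defect representing that extension, so it differs from [F] by a
    trivial map. *)
Lemma rho_ext_gauge F r : quasilinear F -> (rho (ext_of F) < r%:E)%E -> ext_gauge F r.
Proof.
move=> hF /ereal_inf_lt[_ [e eF ->]] /ereal_inf_lt[_ [B [[Bh Bfin] BP] <-] Br].
have Bxy x y w : ext_inj e w = B (x + y) - B x - B y ->
    qnorm w / (qnorm x + qnorm y) <= r.
  move=> wE; rewrite -lee_fin; apply: le_trans (ltW Br).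
  by apply: ereal_sup_ubound; exists x, y, w.
have r0 : 0 <= r.
  apply: le_trans (Bxy 0 0 0 _); first by rewrite qnorm0 mul0r.
  by rewrite linear0 addr0 subrr (homogeneous0 Bh) subrr.
have [C CB] : exists C, forall x, qnorm (B x) <= C * qnorm x.
  by have [C [_ _ CB]] := (homogeneous_boundedP _).1 (conj Bh Bfin); exists C.
have [|G Gr eG] := section_represents Bh BP CB r0.
  move=> x y w wE; have := Bxy x y w wE.
  have := addr_ge0 (qnorm_ge0 x) (qnorm_ge0 y).
  rewrite le_eqVlt => /orP[/eqP n0 _|n0]; last by rewrite ler_pdivrMr.
  move/esym/eqP: n0; rewrite paddr_eq0 ?qnorm_ge0 //.
  move=> /andP[/eqP/qnorm_eq0 x0 /eqP/qnorm_eq0 y0].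
  move: wE; rewrite x0 y0 addr0 (homogeneous0 Bh) !subrr => w0.
  have -> : w = 0 by apply: (@ext_inj_injective _ _ _ _ e); rewrite w0 linear0.
  by rewrite !qnorm0 addr0 mulr0.
have hG : quasilinear G by apply/quasilinearP; exists r.
have : ext_of F = ext_of G.
  rewrite (ext_of_represents hG eG) (ext_ofE hF); apply/ext_class_eqP.
  by move: eF; rewrite (ext_ofE hF).
move=> /(ext_of_eqP hF hG)[L FGL]; exists (F - G - (L : X -> Y)) => //.
have -> : F - (F - G - (L : X -> Y)) = G - (- (L : X -> Y)).
  by rewrite (opprB (F - G)) opprK addrCA subKr addrC.
have [|L' L'E] := @linear_map_of _ X Y (fun x => - L x).
  by move=> a x y; rewrite linearP opprD scalerN.
have -> : - (L : X -> Y) = L' by apply/funext => x; rewrite L'E.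
exact: dgauge_subl.
Qed.

Lemma hausdorff_extP : hausdorff (ext_topology X Y) <-> trivial_maps_closed X Y.
Proof.
rewrite (@hausdorff_induced_topologyP R s _ (mtri X Y) ext_gauge (Ext X Y) (ext0 X Y)
  (@ext_add R s X Y) (@ext_scale R s X Y) (@rho R s X Y) ext_of) //.
- split=> H F F0.
    have hF : quasilinear F by apply/ext_gauge_domP; exists 1; exact: F0.
    have := H F F0; rewrite -ext_of0 => /(ext_of_eqP hF quasilinear0)[L].
    rewrite subr0 => FL; exists (F - (L : X -> Y)) => //.
    by rewrite /= subKr => e e0; apply: dgauge_linear; exact: ltW.
  have hF : quasilinear F by apply/ext_gauge_domP; exists 1; exact: F0.
  rewrite -ext_of0; apply/(ext_of_eqP hF quasilinear0).
  have [B Bb /dgauge_null_linear[L LE]] := H F F0.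
  by exists L; rewrite subr0 -LE subKr.
- exact: mtri_ge1.
- exact: ext_gauge_gauge.
- by move=> c; have [F /ext_gauge_domP hF ->] := ext_of_onto c; exists F.
- exact: ext_of0.
- by move=> F G /ext_gauge_domP hF /ext_gauge_domP hG; exact: ext_ofD.
- by move=> a F /ext_gauge_domP hF; exact: ext_ofZ.
- by move=> F r /ext_gauge_domP hF; exact: rho_ext_gauge.
- exact: ext_gauge_rho.
Qed.

End ExtensionSpace.

Theorem theorem2 (R : realType) (s : scalars) (X Y : quasiBanachType R s) :
  hausdorff (ext_topology X Y) <-> K0 X Y \is a fin_num.
Proof.
by rewrite hausdorff_extP trivial_maps_closedP K0_fin_numP.
Qed.
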